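(* Let $G=(V,E)$ be a finite weighted graph on $N$ vertices with vertex measure $\mu$ and $\Gamma$-valued signature $\sigma$, where $\Gamma$ is $S^1$ or $S^1_k$. Suppose $(G,\sigma)$ has isoperimetric dimension $\delta>2$ with isoperimetric constant $c_\delta>0$. Let $\lambda_1\le\cdots\le\lambda_N$ be the eigenvalues of $\Delta_\sigma$. Then there is a constant $C_\delta$ depending only on $\delta$, $c_\delta$ and $d_\mu$ such that for every $t>0$, $$\sum_{j=1}^N e^{-\lambda_j t}\le C_\delta\frac{\mathrm{vol}_\mu(G)}{t^{\delta/2}}.$$
   Context: $G=(V,E)$ undirected simple finite; edge weights $w_{uv}=w_{vu}>0$; $\mu:V\to(0,\infty)$; $d_u=\sum_{v\sim u}w_{uv}$, $d_\mu=\max_u d_u/\mu(u)$; $|E(X,X^c)|=\sum_{u\in X,v\notin X}w_{uv}$; $\mathrm{vol}_\mu(X)=\sum_{u\in X}\mu(u)$, $\mathrm{vol}_\mu(G)=\mathrm{vol}_\mu(V)$. $S^1=\{z\in\mathbb{C}:|z|=1\}$, $S^1_k=\{e^{2\pi ij/k}:j=1,\dots,k\}$. A signature is $\sigma:E^{or}\to\Gamma$ on oriented edges with $\sigma_{vu}=\sigma_{uv}^{-1}$. For nonempty $V_1\subseteq V$ with induced edge set $E_1$, $\iota^\sigma(V_1)=\min_{\tau:V_1\to\Gamma}\sum_{\{u,v\}\in E_1}w_{uv}|\tau(u)-\sigma_{uv}\tau(v)|$. $(G,\sigma)$ has isoperimetric dimension $\delta$ with constant $c_\delta$ if $\iota^\sigma(V_1)+|E(V_1,V_1^c)|\ge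 c_\delta\mathrm{vol}_\mu(V_1)^{(\delta-1)/\delta}$ for all nonempty $V_1\subseteq V$. The magnetic Laplacian acts on $f:V\to\mathbb{C}$ by $\Delta_\sigma f(u)=\frac{1}{\sqrt{\mu(u)}}\sum_{v\sim u}w_{uv}\Big(\frac{f(u)}{\sqrt{\mu(u)}}-\sigma_{uv}\frac{f(v)}{\sqrt{\mu(v)}}\Big)$; it is Hermitian, with real eigenvalues listed with multiplicity. *)

(* Defs.v *)
From HB Require Import structures.
From mathcomp Require Import all_boot all_order all_algebra.
From mathcomp Require Import ring complex.
From mathcomp Require Import boolp classical_sets reals sequences exp trigo.

Set Implicit Arguments.
Unset Strict Implicit.
Unset Printing Implicit Defensive.

Import Order.TTheory GRing.Theory Num.Theory.

Local Open Scope classical_set_scope.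
Local Open Scope ring_scope.
Local Open Scope complex_scope.

Record wgraph (R : realType) (V : finType) := WGraph {
  adj : rel V;
  adj_sym : symmetric adj;
  adj_irr : irreflexive adj;
  weight : V -> V -> R;
  weight_sym : forall u v, weight u v = weight v u;
  weight_gt0 : forall u v, adj u v -> 0 < weight u v;
  vmeas : V -> R;
  vmeas_gt0 : forall u, 0 < vmeas u
}.

Definition unit_circle (R : realType) : set R[i] := [set z | Normc.normc z = 1].

Definition cyclic_circle (R : realType) (k : nat) : set R[i] :=
  [set z | exists2 j : nat, (1 <= j <= k)%N &
     z = cos (2 * pi * j%:R / k%:R) +i* sin (2 * pi * j%:R / k%:R)].

Arguments unit_circle : clear implicits.
Arguments cyclic_circle : clear implicits.

Section Graph.
Variables (R : realType) (V : finType) (G : wgraph R V).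

Definition wdeg (u : V) : R := \sum_(v | adj G u v) weight G u v.

(* All the ratios are nonnegative, so the default value 0 only matters when V
   is empty. *)
Definition max_deg : R := \big[Num.max/0]_(u : V) (wdeg u / vmeas G u).

Definition cut (X : {set V}) : R :=
  \sum_(u in X) \sum_(v | (v \notin X) && adj G u v) weight G u v.

Definition vol (X : {set V}) : R := \sum_(u in X) vmeas G u.

(* Values of [sigma] on non-adjacent pairs are irrelevant. *)
Definition signature (Gamma : set R[i]) (sigma : V -> V -> R[i]) : Prop :=
  forall u v, adj G u v -> Gamma (sigma u v) /\ sigma v u = (sigma u v)^-1.

(* The summand is symmetric in u and v because sigma v u = (sigma u v)^-1 has
   modulus 1; halving the sum over ordered pairs counts each edge once. *)
Definition frustration (sigma : V -> V -> R[i]) (X : {set V})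
    (tau : V -> R[i]) : R :=
  2^-1 * \sum_(u in X) \sum_(v in X | adj G u v)
           weight G u v * Normc.normc (tau u - sigma u v * tau v).

(* The infimum is a minimum: the admissible values of tau on X form a nonempty
   compact set when Gamma is the circle or a finite group of roots of unity,
   and [frustration] depends on tau only through its restriction to X. *)
Definition frustration_index (Gamma : set R[i]) (sigma : V -> V -> R[i])
    (X : {set V}) : R :=
  inf [set frustration sigma X tau | tau in
         [set tau : V -> R[i] | forall u, u \in X -> Gamma (tau u)]].

Definition isoperimetric_dim (Gamma : set R[i]) (sigma : V -> V -> R[i])
    (delta c : R) : Prop :=
  forall X : {set V}, X != finset.set0 ->
    c * vol X `^ ((delta - 1) / delta)
      <= frustration_index Gamma sigma X + cut X.

Section Laplacian.
Variable sigma : V -> V -> R[i].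

Definition magnetic_laplacian (f : {ffun V -> R[i]^o}) : {ffun V -> R[i]^o} :=
  [ffun u => (Num.sqrt (vmeas G u))%:C^-1 *
     \sum_(v | adj G u v) (weight G u v)%:C *
       (f u / (Num.sqrt (vmeas G u))%:C
        - sigma u v * (f v / (Num.sqrt (vmeas G v))%:C))].

Fact magnetic_laplacian_linear : linear magnetic_laplacian.
Proof.
move=> a f g; apply/ffunP => u; rewrite !ffunE.
rewrite -[X in _ = X + _]/(a * _) mulrCA -mulrDr; congr (_ * _).
rewrite mulr_sumr -big_split; apply: eq_bigr => v _ /=; rewrite !ffunE.
rewrite /GRing.scale/=; ring.
Qed.

HB.instance Definition _ := GRing.isLinear.Build R[i] {ffun V -> R[i]^o}
  {ffun V -> R[i]^o} _ magnetic_laplacian magnetic_laplacian_linear.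

(* lam_1 <= ... <= lam_N with N = #|V|. As the tuple has length #|V|, the
   multiplicity condition forces it to list the whole spectrum. *)
Definition is_spectrum (lam : #|V|.-tuple R) : Prop :=
  sorted <=%R lam /\
  forall a : R,
    count_mem a lam =
      \dim (passmx.leigenspace (linfun magnetic_laplacian) a%:C).

End Laplacian.
End Graph.

(* Main.v *)
(** The argument is Nash's. Averaging the phase [g / |g|] over rotations (and,
for [k]-th roots of unity, rounding it to the group) bounds the frustration
index of every superlevel set of [|g|^2]; summing the isoperimetric inequality
over the superlevel sets of [max 0 (|g|^2 - s^2)], whose volume is at most
[||g||_1 / s], gives with Cauchy-Schwarz and the choice [s = ||g||_2^2 / (2 ||g||_1)]
a Nash inequality [kappa ||g||_2^(2 + 4/delta) <= E(g) ||g||_1^(4/delta)].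

The heat semigroup is replaced by its backward Euler scheme
[u_(k+1) = (1 + s Delta)^-1 u_k], started at a point mass at [x]. The triangle
inequality shows that a step does not increase the [L^1] norm, and it decreases
[||u_k||_2^2] by at least [2 s E(u_(k+1))], so the Nash inequality forces
[||u_k||_2^2 <= C mu(x) (k s)^(-delta/2)]. Summed over [x] the left-hand side is
[\sum_j (1 + s lambda_j)^(-2k)], which for [2 k s = t] dominates the heat trace,
since [1 + y <= exp y]. *)

Require Import Defs.
From mathcomp Require Import all_boot all_order all_algebra.
From mathcomp Require Import ring lra complex.
From mathcomp Require Import boolp classical_sets reals sequences exp trigo.
From mathcomp Require Import interval_inference topology normedtype derive realfun.

Set Implicit Arguments.
Unset Strict Implicit.
Unset Printing Implicit Defensive.

Import Order.TTheory GRing.Theory Num.Theory.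
Import numFieldNormedType.Exports.

Local Open Scope ring_scope.
Local Open Scope complex_scope.

(** * Points of the unit circle *)

Section Cis.
Variable R : realType.
Implicit Types x y t : R.

Lemma sin_le x : 0 <= x -> sin x <= x.
Proof.
rewrite le_eqVlt => /predU1P[<-|x0]; first by rewrite sin0.
have [|z _] := @MVT R sin cos 0 x x0 (fun z _ => is_derive_sin z).
  by apply: continuous_subspaceT => ?; exact: continuous_sin.
by rewrite sin0 !subr0 => ->; rewrite ler_piMl ?cos_le1 ?ltW.
Qed.

(** With [y = x / 2], the mean value theorem gives [sin y >= y * cos y]. Hence
    [sin x = 2 sin y cos y] is at least [y * 2 cos^2 y = y * (1 + cos x)], and [cos x >= 0] in this
    range. *)
Lemma half_le_sin x : 0 <= x <= pi / 2 -> x / 2 <= sin x.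
Proof.
move=> /andP[]; rewrite le_eqVlt => /predU1P[<-|x0 xpi]; first by rewrite sin0 mul0r.
have y0 : 0 < x / 2 by rewrite divr_gt0.
have pi0 : 0 < pi :> R := pi_gt0 R.
have [|z] := @MVT R sin cos 0 (x / 2) y0 (fun z _ => is_derive_sin z).
  by apply: continuous_subspaceT => ?; exact: continuous_sin.
rewrite sin0 !subr0 in_itv/= => /andP[z0 zy] siny.
have cyz : cos (x / 2) <= cos z.
  by rewrite leNgt ltr_cos ?in_itv/= -?leNgt; [exact: ltW|apply/andP; split; lra..].
have cy : 0 <= cos (x / 2) by rewrite cos_ge0_pihalf//; apply/andP; split; lra.
have cx : 0 <= cos x by rewrite cos_ge0_pihalf//; apply/andP; split; lra.
have xE : x = x / 2 + x / 2 by lra.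
rewrite [in leRHS]xE sinD; rewrite xE cosD in cx.
have := cos2Dsin2 (x / 2) => E.
rewrite siny in cx E *; set c := cos (x / 2) in cyz cy cx E *; set y := x / 2 in cx E y0 *.
have : y * c * c <= y * (cos z) * c.
  by apply: ler_wpM2r => //; apply: ler_wpM2l => //; exact: ltW.
have : y <= y * c * c * 2.
  have c2 : 1 <= c * c * 2 by lra.
  have -> : y * c * c * 2 = y * (c * c * 2) by ring.
  by rewrite ler_peMr// ltW.
lra.
Qed.

Definition cis t : R[i] := cos t +i* sin t.

Lemma cisD x y : cis (x + y) = cis x * cis y.
Proof.
apply/eqP; rewrite eq_complex /= cosD sinD; apply/andP; split; apply/eqP => //.
by rewrite addrC.
Qed.

Lemma normc_cis t : Normc.normc (cis t) = 1.
Proof. by rewrite /= cos2Dsin2 sqrtr1. Qed.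

Lemma cisDpi n t : cis (t + 2 * pi * n%:R) = cis t.
Proof.
elim: n => [|n IHn]; first by rewrite mulr0 addr0.
rewrite -[RHS]IHn -[n.+1%:R]natr1 mulrDr mulr1 addrA /cis.
by rewrite [2 * pi]mulr_natl cosD2pi sinD2pi.
Qed.

Lemma normc_cisB x y :
  Normc.normc (cis x - cis y) = 2 * `|sin ((x - y) / 2)|.
Proof.
rewrite /=; apply/eqP; rewrite -(@eqrXn2 _ 2) ?sqrtr_ge0 ?mulr_ge0//.
rewrite sqr_sqrtr ?addr_ge0 ?sqr_ge0// exprMn real_normK ?num_real//.
have -> : x = y + ((x - y) / 2 + (x - y) / 2) by lra.
set a := (x - y) / 2; have -> : (y + (a + a) - y) / 2 = a by lra.
rewrite !(cosD, sinD); have := cos2Dsin2 a; have := cos2Dsin2 y.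
set c := cos a; set s := sin a; set d := cos y; set e := sin y => E1 E2.
apply/eqP.
have -> : s ^+ 2 = 1 - c ^+ 2 by rewrite -E2; ring.
(* The factor [cis y], of modulus one, is pulled out of the difference. *)
transitivity ((d ^+ 2 + e ^+ 2) * ((c * c - s * s - 1) ^+ 2 + (s * c + c * s) ^+ 2)); first by ring.
rewrite E1 mul1r.
have -> : (c * c - s * s - 1) ^+ 2 + (s * c + c * s) ^+ 2
  = (c ^+ 2 + s ^+ 2) ^+ 2 + 1 - 2 * c ^+ 2 + 2 * s ^+ 2 by ring.
rewrite E2; have -> : s ^+ 2 = 1 - c ^+ 2 by rewrite -E2; ring.
ring.
Qed.

Lemma normc_cisB_le x y : Normc.normc (cis x - cis y) <= `|x - y|.
Proof.
rewrite normc_cisB; set z := x - y.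
have -> : `|sin (z / 2)| = `|sin (`|z| / 2)|.
  by have [//|_] := ger0P z; rewrite mulNr sinN normrN.
have z0 := normr_ge0 z; set w := `|z| in z0 *.
suff : `|sin (w / 2)| <= w / 2 by move=> h; lra.
have w0 : 0 <= w / 2 by lra.
have [h|h] := ger0P (sin (w / 2)); first exact: sin_le.
(* A negative sine forces [w / 2 > pi >= 2], beyond any value of a sine. *)
have [w2|w2] := leP (w / 2) pi.
  by have := @sin_ge0_pi _ (w / 2); rewrite w0 w2 leNgt h => /(_ isT).
have := sin_geN1 (w / 2); have := pi_ge2 R; lra.
Qed.

Lemma le_normc_cisB x y : `|x - y| <= pi -> `|x - y| <= 2 * Normc.normc (cis x - cis y).
Proof.
rewrite normc_cisB; set z := x - y.
have -> : `|sin (z / 2)| = `|sin (`|z| / 2)|.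
  by have [//|_] := ger0P z; rewrite mulNr sinN normrN.
have z0 := normr_ge0 z; set w := `|z| in z0 * => wpi.
have := @half_le_sin (w / 2); have := ler_norm (sin (w / 2)).
move=> h /(_ _); have -> : 0 <= w / 2 <= pi / 2 by apply/andP; split; lra.
move=> /(_ isT); lra.
Qed.

(** The angle is taken nonnegative so that [fine_approx] can round it down to a natural number of
    grid steps. *)
Lemma cis_surj (z : R[i]) : Normc.normc z = 1 -> exists2 t, 0 <= t & z = cis t.
Proof.
case: z => a b /= /(congr1 (fun x => x ^+ 2)).
rewrite sqr_sqrtr ?addr_ge0 ?sqr_ge0// expr1n => ab.
have a1 : -1 <= a <= 1 by apply/andP; split; nra.
have sE : sin (acos a) = `|b|.
  by rewrite sin_acos// -ab [X in X - _]addrC addrK sqrtr_sqr.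
have cE : cos (acos a) = a by rewrite acosK// in_itv.
have [b0|b0] := leP 0 b.
  by exists (acos a); rewrite ?acos_ge0// /cis sE cE ger0_norm.
exists (- acos a + 2 * pi * 1%:R).
  by have := acos_lepi a1; have := pi_ge0 R; lra.
by rewrite cisDpi /cis cosN sinN sE cE ltr0_norm// opprK.
Qed.

End Cis.

(* Hermite's identity. *)
Lemma sum_divnD M a : (0 < M)%N -> (\sum_(j < M) (a + j) %/ M = a)%N.
Proof.
case: M => // M _; elim: a => [|a IHa].
  by rewrite big1// => j _; rewrite add0n divn_small.
rewrite -[a.+1]addn1 -[in RHS]IHa big_ord_recr big_ord_recl /= addn0.
have -> : (a + 1 + M = a + M.+1)%N by rewrite -addnA add1n.
rewrite divnDr ?dvdnn// divnn/= addnA; congr (_ + _)%N.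
rewrite addnC; congr (_ + _)%N; apply: eq_bigr => j _.
by rewrite /bump /= -addnA.
Qed.

(** * Rounding phases to roots of unity *)

Section Rounding.
Variable R : realType.
Local Notation normc := (@Normc.normc R).

Lemma normcB (x y : R[i]) : normc (x - y) = normc (y - x).
Proof. by rewrite -normcN opprB. Qed.

Definition root_of_unity_cis k n : R[i] := cis (2 * pi * n%:R / k%:R).

Lemma root_of_unity_cisD k m n :
  root_of_unity_cis k (m + n) = root_of_unity_cis k m * root_of_unity_cis k n.
Proof. by rewrite /root_of_unity_cis natrD mulrDr mulrDl cisD. Qed.

Lemma root_of_unity_cis_mod k m n : (0 < k)%N ->
  root_of_unity_cis k (m + k * n) = root_of_unity_cis k m.
Proof.
move=> k0; rewrite /root_of_unity_cis natrD natrM.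
have k0' : k%:R != 0 :> R by rewrite pnatr_eq0 -lt0n.
by rewrite -[RHS](cisDpi n); congr (cis _); field.
Qed.

Lemma cyclic_circleP k z : (0 < k)%N ->
  cyclic_circle R k z <-> exists n, z = root_of_unity_cis k n.
Proof.
move=> k0; split=> [[n _ ->]|[n ->]]; first by exists n.
have [nk|nk] := posnP (n %% k).
  (* The group is listed with exponents from [1] to [k], so the residue [0] is represented by
     [k]. *)
  exists k; first by rewrite k0 leqnn.
  rewrite -[LHS]/(root_of_unity_cis k n) -[RHS]/(root_of_unity_cis k k).
  rewrite (divn_eq n k) nk addn0 -[(_ * k)%N]add0n mulnC root_of_unity_cis_mod//.
  by have := root_of_unity_cis_mod 0 1 k0; rewrite muln1 add0n => ->.
exists (n %% k)%N; first by rewrite nk ltnW// ltn_pmod.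
rewrite -[RHS]/(root_of_unity_cis k (n %% k)).
by rewrite {1}(divn_eq n k) addnC mulnC root_of_unity_cis_mod.
Qed.

Lemma normc_root_of_unity_cis k n : normc (root_of_unity_cis k n) = 1.
Proof. exact: normc_cis. Qed.

Variables k M : nat.
Hypotheses (k0 : (0 < k)%N) (M0 : (0 < M)%N).
Local Notation fine n := (root_of_unity_cis (k * M) n).
Local Notation coarse n := (root_of_unity_cis k (n %/ M)).

(** Each chord is at most its arc, [2 pi / k] times a difference of quotients. By Hermite's identity
    these differences add up to [r], so the total is [M] times the fine arc. As [2 r <= k M], the
    fine arc is at most [pi], hence at most twice its chord. *)
Lemma sum_coarse_le a r : (2 * r <= k * M)%N ->
  \sum_(j < M) normc (coarse (a + r + j) - coarse (a + j)) <=
    2 * M%:R * normc (fine (a + r) - fine a).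
Proof.
move=> rkM.
have kR : 0 < k%:R :> R by rewrite ltr0n.
have MR : 0 < M%:R :> R by rewrite ltr0n.
have pi0 := pi_gt0 R.
have rkMR : 2 * r%:R <= k%:R * M%:R :> R by rewrite -!natrM ler_nat.
apply: (@le_trans _ _ (\sum_(j < M) (2 * pi / k%:R) *
    (((a + r + j) %/ M)%:R - ((a + j) %/ M)%:R))).
  apply: ler_sum => j _; apply: le_trans (normc_cisB_le _ _) _.
  set x : R := (_ %/ _)%:R; set y : R := (_ %/ _)%:R.
  have -> : 2 * pi * x / k%:R - 2 * pi * y / k%:R = 2 * pi / k%:R * (x - y) by ring.
  rewrite ger0_norm// mulr_ge0//; first by rewrite divr_ge0 ?mulr_ge0 ?ltW.
  by rewrite subr_ge0 ler_nat leq_div2r// leq_add2r leq_addr.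
rewrite -mulr_sumr sumrB -!natr_sum !sum_divnD// natrD addrC addKr.
have aE : 2 * pi * (a + r)%:R / (k * M)%:R - 2 * pi * a%:R / (k * M)%:R
    = 2 * pi * (r%:R / (k%:R * M%:R)) :> R.
  by rewrite natrD natrM; field; rewrite !gt_eqF.
have := @le_normc_cisB R (2 * pi * (a + r)%:R / (k * M)%:R) (2 * pi * a%:R / (k * M)%:R).
rewrite aE ger0_norm; last by rewrite !(mulr_ge0, divr_ge0)// ltW.
have q : r%:R / (k%:R * M%:R) <= 2^-1 :> R.
  by rewrite ler_pdivrMr ?mulr_gt0// ler_pdivlMl.
have pq : 2 * pi * (r%:R / (k%:R * M%:R)) <= pi :> R.
  have pi0' := ltW pi0; rewrite mulrAC ler_piMl//.
  move: q; set z := _ / _ => q; lra.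
move=> /(_ pq) => h.
have -> : 2 * pi / k%:R * r%:R = M%:R * (2 * pi * (r%:R / (k%:R * M%:R))) :> R.
  by field; rewrite !gt_eqF.
by rewrite [2 * M%:R]mulrC -[leRHS]mulrA ler_pM2l.
Qed.

(** Both sides depend on [a] and [b] only modulo [k * M], which reduces the claim to two exponents
    at most half a turn apart. *)
Lemma sum_coarse_dist_le a b :
  \sum_(j < M) normc (coarse (a + j) - coarse (b + j)) <=
    2 * M%:R * normc (fine a - fine b).
Proof.
have kM0 : (0 < k * M)%N by rewrite muln_gt0 k0.
have coarse_mod c n : coarse (c + k * M * n) = coarse c.
  rewrite mulnAC divnDMl//.
  by rewrite root_of_unity_cis_mod.
have per c d (i : nat) n : (c + k * M * n = d)%N -> coarse (d + i) = coarse (c + i).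
  by move=> <-; rewrite addnAC coarse_mod.
have perf c d n : (c + k * M * n = d)%N -> fine d = fine c.
  by move=> <-; rewrite root_of_unity_cis_mod.
(* Adding a multiple of [k * M] makes the truncated subtraction [A - b] exact. *)
pose A := (a + k * M * b)%N.
have bA : (b <= A)%N by rewrite (leq_trans _ (leq_addl _ _))// leq_pmull.
pose r := ((A - b) %% (k * M))%N; pose n := ((A - b) %/ (k * M))%N.
have E : (b + r + k * M * n = A)%N.
  by rewrite -addnA [(r + _)%N]addnC mulnC -divn_eq subnKC.
have rlt : (r < k * M)%N by rewrite ltn_pmod.
have aE i : coarse (a + i) = coarse (b + r + i).
  by rewrite -(per _ _ i _ E) (per a A i b).
have faE : fine a = fine (b + r) by rewrite -(perf _ _ _ E) (perf a A b).
have [rle|rgt] := leqP (2 * r) (k * M).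
  by under eq_bigr do rewrite aE; rewrite faE sum_coarse_le.
(* Beyond half a turn, the complementary arc from [a] to [b] is used instead. *)
pose r' := (k * M - r)%N.
have E' : (b + k * M * 1 = b + r + r')%N by rewrite muln1 -addnA subnKC// ltnW.
have bE i : coarse (b + i) = coarse (b + r + r' + i) by rewrite -(per _ _ i _ E').
have fbE : fine b = fine (b + r + r') by rewrite -(perf _ _ _ E').
under eq_bigr do rewrite aE bE normcB; rewrite faE fbE normcB sum_coarse_le//.
by rewrite mulnBr leq_subLR mul2n -addnn leq_add2r ltnW.
Qed.

Lemma fine_approx z : normc z = 1 ->
  exists n, normc (z - fine n) <= 2 * pi / (k * M)%:R.
Proof.
move=> /cis_surj[t t0 ->].
have kMR : 0 < (k * M)%:R :> R by rewrite ltr0n muln_gt0 k0.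
have s0 : 0 < 2 * pi / (k * M)%:R :> R.
  by rewrite divr_gt0// mulr_gt0// pi_gt0.
exists (Num.truncn (t / (2 * pi / (k * M)%:R))).
apply: le_trans (normc_cisB_le _ _) _.
set s := 2 * pi / _ in s0 *.
have -> : 2 * pi * (Num.truncn (t / s))%:R / (k * M)%:R = s * (Num.truncn (t / s))%:R.
  by rewrite /s; ring.
have /truncn_itv /andP[h1 h2] : 0 <= t / s by rewrite divr_ge0// ltW.
rewrite ler_pdivlMr// mulrC in h1.
rewrite ltr_pdivrMr// -natr1 mulrDl mul1r mulrC in h2.
rewrite ger0_norm; lra.
Qed.

End Rounding.

(** * Frustration index against the frustration of arbitrary phases *)

Section FrustrationIndex.
Variables (R : realType) (V : finType) (G : wgraph R V) (sigma : V -> V -> R[i]).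
Local Notation normc := (@Normc.normc R).
Implicit Types (X : {set V}) (tau p : V -> R[i]).

Lemma frustration_ge0 X tau : 0 <= frustration G sigma X tau.
Proof.
rewrite mulr_ge0 ?invr_ge0//; apply: sumr_ge0 => u _; apply: sumr_ge0 => v /andP[_ uv].
rewrite mulr_ge0 ?(ltW (weight_gt0 uv))//; case: (_ - _) => a b; exact: sqrtr_ge0.
Qed.

Lemma frustration_index_le_frustration (Gamma : set R[i]) X tau :
  (forall u, u \in X -> Gamma (tau u)) ->
  frustration_index G Gamma sigma X <= frustration G sigma X tau.
Proof.
move=> tauP; apply: ge_inf; last by exists tau.
by exists 0 => _ [p _ <-]; exact: frustration_ge0.
Qed.

(* The phase of [p u] is approximated by a [k M]-th root of unity with exponent
   [n u]; the candidates [tau j] round the exponents [n u + j] down to multiples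
   of [M], which commutes with multiplication by [k]-th roots of unity. By
   Hermite's identity the rounding errors average out over [j < M], leaving an
   error of order [1 / M]. *)
Lemma frustration_index_cyclic_le k X p : (0 < k)%N ->
  signature G (cyclic_circle R k) sigma -> (forall u, normc (p u) = 1) ->
  frustration_index G (cyclic_circle R k) sigma X <= 2 * frustration G sigma X p.
Proof.
move=> k0 sig p1.
pose W := \sum_(u in X) \sum_(v in X | adj G u v) weight G u v.
have W0 : 0 <= W.
  by apply: sumr_ge0 => u _; apply: sumr_ge0 => v /andP[_ /weight_gt0/ltW].
have pi0 := pi_gt0 R.
(* Each endpoint of an edge is off by at most [2 pi / (k M)]. After the factor [2 M] of
   [sum_coarse_dist_le] this costs at most [8 pi] per ordered pair; dividing by [M] and halving
   gives [4 pi W / M]. *)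
have bound M : (0 < M)%N ->
    frustration_index G (cyclic_circle R k) sigma X <=
    2 * frustration G sigma X p + 4 * pi * W / M%:R.
  move=> M0.
  have MR : 0 < M%:R :> R by rewrite ltr0n.
  have /choice[n nP] : forall u, exists n,
      normc (p u - root_of_unity_cis R (k * M) n) <= 2 * pi / (k * M)%:R.
    by move=> u; exact: fine_approx.
  pose tau (j : nat) u := root_of_unity_cis R k ((n u + j) %/ M).
  have tauX j : frustration_index G (cyclic_circle R k) sigma X <=
      frustration G sigma X (tau j).
    apply: frustration_index_le_frustration => u _.
    by apply/cyclic_circleP => //; eexists.
  have : \sum_(j < M) frustration_index G (cyclic_circle R k) sigma X <=
      \sum_(j < M) frustration G sigma X (tau j) by apply: ler_sum => j _.
  rewrite sumr_const card_ord -[_ *+ M]mulr_natl /frustration -mulr_sumr exchange_big /=.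
  under eq_bigr do rewrite exchange_big/=.
  move=> h; rewrite -(ler_pM2l MR); apply: le_trans h _.
  set S := (Y in 2 * (2^-1 * Y)).
  have -> : M%:R * (2 * (2^-1 * S) + 4 * pi * W / M%:R)
      = 2^-1 * (2 * M%:R * S + 8 * pi * W) by field; rewrite gt_eqF.
  rewrite ler_pM2l ?invr_gt0// /S /W !mulr_sumr -big_split/=.
  apply: ler_sum => u _; rewrite !mulr_sumr -big_split/=.
  apply: ler_sum => v /andP[_ uv]; rewrite -mulr_sumr.
  have [/(cyclic_circleP _ k0)[l lE] _] := sig _ _ uv.
  have -> : 2 * M%:R * (weight G u v * normc (p u - sigma u v * p v)) +
      8 * pi * weight G u v =
      weight G u v * (2 * M%:R * normc (p u - sigma u v * p v) + 8 * pi) by ring.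
  apply: ler_wpM2l; first exact/ltW/weight_gt0.
  have tauE (j : nat) : sigma u v * tau j v =
      root_of_unity_cis R k (((n v + l * M) + j) %/ M).
    by rewrite lE -root_of_unity_cisD addnAC [in RHS]addnC divnMDl.
  under eq_bigr do rewrite tauE.
  apply: le_trans (sum_coarse_dist_le _ k0 M0 _ _) _.
  have fE : root_of_unity_cis R (k * M) (n v + l * M) =
      sigma u v * root_of_unity_cis R (k * M) (n v).
    rewrite addnC root_of_unity_cisD lE; congr (_ * _).
    by rewrite /root_of_unity_cis !natrM; congr cis; field; rewrite !pnatr_eq0 -!lt0n k0.
  rewrite fE; set fu := root_of_unity_cis _ _ (n u); set fv := root_of_unity_cis _ _ (n v).
  have -> : fu - sigma u v * fv =
      (p u - sigma u v * p v) - (p u - fu) + sigma u v * (p v - fv) by ring.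
  have tri : normc ((p u - sigma u v * p v) - (p u - fu) + sigma u v * (p v - fv)) <=
      normc (p u - sigma u v * p v) + normc (p u - fu) + normc (p v - fv).
    apply: le_trans (le_normcD _ _) _.
    rewrite Normc.normcM lE normc_root_of_unity_cis mul1r lerD2r.
    by apply: le_trans (le_normcD _ _) _; rewrite normcN.
  have kR : 1 <= k%:R :> R by rewrite ler1n.
  have th : 2 * M%:R * (2 * pi / (k * M)%:R) <= 4 * pi :> R.
    rewrite natrM; have -> : 2 * M%:R * (2 * pi / (k%:R * M%:R)) = 4 * pi / k%:R :> R.
      by field; rewrite !gt_eqF// (lt_le_trans ltr01).
    by rewrite ler_pdivrMr ?(lt_le_trans ltr01)// ler_peMr//; lra.
  apply: le_trans (_ : 2 * M%:R * (normc (p u - sigma u v * p v) +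
     2 * pi / (k * M)%:R + 2 * pi / (k * M)%:R) <= _); last by lra.
  rewrite ler_pM2l ?mulr_gt0//; apply: le_trans tri _.
  by have := nP u; have := nP v; lra.
apply/ler_addgt0Pr => e e0.
pose M := (Num.truncn (4 * pi * W / e)).+1.
have MR : 0 < M%:R :> R by rewrite ltr0n.
apply: le_trans (bound M isT) _; rewrite lerD2l.
rewrite ler_pdivrMr// [e * _]mulrC -ler_pdivrMr//.
by rewrite ltW// /M truncnS_gt.
Qed.

End FrustrationIndex.

(** * Layer cake and the edgewise coarea bound *)

Section LayerCake.
Variable R : realType.

(** The list pairs each gap between consecutive values with its lower endpoint as threshold; the
    gaps below [x] telescope to [x - x0]. *)
Lemma sorted_layer_cake (x0 : R) (s : seq R) : path <=%R x0 s ->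
  exists2 l : seq (R * R),
    (forall c, c \in l -> 0 <= c.1 /\ x0 <= c.2) &
    forall x, x \in x0 :: s -> \sum_(c <- l) c.1 * (c.2 < x)%R%:R = x - x0.
Proof.
elim: s x0 => [|x1 s IHs] x0 /=.
  by exists [::] => // x; rewrite inE => /eqP->; rewrite big_nil subrr.
move=> /andP[x01 x1s]; have [l l0 lE] := IHs _ x1s.
exists ((x1 - x0, x0) :: l).
  move=> c; rewrite inE => /predU1P[->/=|/l0[c1 c2]]; first by rewrite subr_ge0.
  by split=> //; exact: le_trans c2.
move=> x; rewrite inE big_cons/= => /predU1P[->|xs].
  rewrite ltxx mulr0 add0r subrr big_seq big1// => c /l0[_ c2].
  by rewrite ltNge (le_trans x01 c2) mulr0.
have x1x : x1 <= x.
  move: xs; rewrite inE => /predU1P[->//|xs].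
  by have /allP/(_ _ xs) := order_path_min le_trans x1s.
rewrite lE//; have [_|xx0] := ltP x0 x; first by rewrite mulr1 addrC addrA subrK.
have -> : x1 = x0 by apply/eqP; rewrite eq_le x01 (le_trans x1x xx0).
by rewrite mulr0 add0r.
Qed.

(** A finite sum with weights [c.1] and thresholds [c.2] stands in for the integral over levels. *)
Lemma layer_cake (V : finType) (F : V -> R) : (forall u, 0 <= F u) ->
  exists2 l : seq (R * R),
    (forall c, c \in l -> 0 <= c.1 /\ 0 <= c.2) &
    forall u, \sum_(c <- l) c.1 * (c.2 < F u)%R%:R = F u.
Proof.
move=> F0; pose s := sort <=%R [seq F u | u <- enum V].
have : path <=%R 0 s.
  rewrite path_sortedE; last exact: le_trans.
  rewrite sort_le_sorted andbT; apply/allP => x.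
  by rewrite mem_sort => /mapP[u _ ->].
move=> /sorted_layer_cake[l l0 lE]; exists l => // u.
by rewrite lE ?subr0// inE mem_sort map_f ?orbT// mem_enum.
Qed.

End LayerCake.

(** * Phases, Dirichlet energy and the bound on a single edge *)

Section Nash.
Variables (R : realType) (V : finType) (G : wgraph R V) (sigma : V -> V -> R[i]).
Local Notation normc := (@Normc.normc R).
Implicit Types (X : {set V}) (g p : V -> R[i]).

Lemma normc_ge0 (z : R[i]) : 0 <= normc z.
Proof. by case: z => a b; exact: sqrtr_ge0. Qed.

Lemma ler_normc_dist (x y : R[i]) : normc x - normc y <= normc (x - y).
Proof. by rewrite lerBlDr -{1}[x](subrK y) le_normcD. Qed.

Lemma max_deg_ge0 : 0 <= max_deg G.
Proof. exact: bigmax_ge_id. Qed.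

Lemma wdeg_le u : wdeg G u <= max_deg G * vmeas G u.
Proof.
rewrite -ler_pdivrMr ?vmeas_gt0//.
exact: (le_bigmax _ (fun u => wdeg G u / vmeas G u)).
Qed.

(** The quadratic form of the magnetic Laplacian in the variable [g = f / sqrt mu]; the half
    corrects for counting both orientations. *)
Definition dirichlet_energy g : R :=
  2^-1 * \sum_u \sum_(v | adj G u v)
    weight G u v * normc (g u - sigma u v * g v) ^+ 2.

(* [phase 0 = 1], so that [phase] always has modulus [1]. *)
Definition phase (z : R[i]) : R[i] := if z == 0 then 1 else z / (normc z)%:C.

Lemma normc_real (x : R) : 0 <= x -> normc x%:C = x.
Proof. by move=> x0; rewrite /= expr0n addr0 sqrtr_sqr ger0_norm. Qed.

Lemma normc_eq0 (z : R[i]) : (normc z == 0) = (z == 0).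
Proof.
by apply/eqP/eqP => [/Normc.eq0_normc//|->]; rewrite Normc.normc0.
Qed.

Lemma normc_phase z : normc (phase z) = 1.
Proof.
rewrite /phase; case: eqP => [_|/eqP z0]; first exact: Normc.normc1.
by rewrite Normc.normcM Normc.normcV normc_real ?normc_ge0// divff ?normc_eq0.
Qed.

Lemma mul_phase z : (normc z)%:C * phase z = z.
Proof.
rewrite /phase; case: eqP => [->|/eqP z0]; first by rewrite Normc.normc0 mul0r.
have nz : (normc z)%:C != 0.
  by apply: contra z0 => /eqP/complexI/eqP; rewrite normc_eq0.
by rewrite mulrC divfK.
Qed.

(** If [|z| <= |w|], then [|z| (p - q) = (z - w) + (|w| - |z|) q], and both terms have modulus at
    most [|z - w|]. Keeping [p] and [q] general covers zero values and phases multiplied by the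
    signature. *)
Lemma min_normc_phase_dist z w (p q : R[i]) : normc p = 1 -> normc q = 1 ->
  (normc z)%:C * p = z -> (normc w)%:C * q = w ->
  Num.min (normc z) (normc w) * normc (p - q) <= 2 * normc (z - w).
Proof.
wlog zw : z w p q / normc z <= normc w => [hw p1 q1 zE wE|].
  have [/hw|/hw h] := orP (le_total (normc z) (normc w)); first exact.
  by rewrite minC normcB [normc (z - w)]normcB h.
move=> p1 q1 zE wE.
rewrite min_l// -{1}[normc z]normc_real ?normc_ge0// -Normc.normcM mulrBr zE.
have -> : z - (normc z)%:C * q = (z - w) + (normc w - normc z)%:C * q.
  by rewrite rmorphB/= mulrBl wE; ring.
apply: le_trans (le_normcD _ _) _.
rewrite Normc.normcM q1 mulr1 normc_real ?subr_ge0//.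
by have := ler_normc_dist w z; rewrite normcB; lra.
Qed.

(** The truncation [F] is monotone, lies below the square and increases no faster than it. With [m]
    the smaller modulus, the phase term is at most [2 m |z - w|]; the other term is the positive
    part of [F |z| - F |w|], at most [(|z| + |w|) |z - w|]. *)
Lemma truncated_edge_le (s : R) (F : R -> R) z w (p q : R[i]) :
  normc p = 1 -> normc q = 1 -> (normc z)%:C * p = z -> (normc w)%:C * q = w ->
  (forall x, F x = Num.max 0 (x ^+ 2 - s ^+ 2)) ->
  Num.min (F (normc z)) (F (normc w)) * normc (p - q) +
    (F (normc z) - Num.min (F (normc z)) (F (normc w))) <=
  2 * ((normc z + normc w) * normc (z - w)).
Proof.
move=> p1 q1 zE wE FE.
have F0 x : 0 <= F x by rewrite FE le_max lexx.
have Fx x : 0 <= x -> F x <= x ^+ 2.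
  by move=> x0; rewrite FE ge_max sqr_ge0/= gerBl sqr_ge0.
have Fmono x y : 0 <= x -> x <= y -> F x <= F y.
  move=> x0 xy; rewrite !FE ge_max !le_max lexx lerD2r/=.
  by rewrite lerXn2r ?orbT// nnegrE (le_trans x0).
have Fdiff x y : 0 <= x -> x <= y -> F y - F x <= (x + y) * (y - x).
  move=> x0 xy; have -> : (x + y) * (y - x) = y ^+ 2 - x ^+ 2 by ring.
  have : x ^+ 2 <= y ^+ 2 by rewrite lerXn2r ?nnegrE// (le_trans x0).
  rewrite !FE; have [|] := leP 0 (x ^+ 2 - s ^+ 2);
    have [|] := leP 0 (y ^+ 2 - s ^+ 2); lra.
have := min_normc_phase_dist p1 q1 zE wE.
have := ler_normc_dist z w; have := normc_ge0 (z - w).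
have := normc_ge0 (p - q).
have := normc_ge0 z; have := normc_ge0 w.
set x := normc z; set y := normc w; set e := normc (z - w); set n := normc (p - q).
move=> y0 x0 n0 e0 xye.
have [xy|/ltW yx] := leP x y.
  have Fxy := Fmono _ _ x0 xy; rewrite min_l// subrr addr0 => h.
  have := ler_wpM2r n0 (Fx _ x0); have := ler_wpM2l x0 h; nra.
have Fyx := Fmono _ _ y0 yx; rewrite (min_r Fyx) => h.
have := ler_wpM2r n0 (Fx _ y0); have := ler_wpM2l y0 h.
have := Fdiff _ _ y0 yx; have := ler_wpM2l (addr_ge0 y0 x0) xye.
nra.
Qed.

End Nash.

(** * Nash inequality *)

Section MagneticNash.
Variables (R : realType) (V : finType) (G : wgraph R V).
Variables (Gamma : set R[i]) (sigma : V -> V -> R[i]).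
Local Notation normc := (@Normc.normc R).
Implicit Types (X : {set V}) (g p : V -> R[i]).

Hypothesis GammaP : Gamma = unit_circle R
  \/ (exists2 k : nat, (0 < k)%N & Gamma = cyclic_circle R k).
Hypothesis sig : signature G Gamma sigma.

Lemma normc_signature u v : adj G u v -> normc (sigma u v) = 1.
Proof.
move=> /sig[+ _]; case: GammaP => [->//|[k k0 ->]] /(cyclic_circleP _ k0)[n ->].
exact: normc_root_of_unity_cis.
Qed.

Lemma frustration_index_le X p : (forall u, normc (p u) = 1) ->
  frustration_index G Gamma sigma X <= 2 * frustration G sigma X p.
Proof.
case: GammaP (sig) => [GE|[k k0 ->]] sg p1; last exact: frustration_index_cyclic_le.
apply: le_trans (@frustration_index_le_frustration _ _ _ _ _ _ p _) _.
  by move=> u _; rewrite GE; exact: p1.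
by rewrite ler_peMl ?frustration_ge0// ler1n.
Qed.

Lemma cut_ge0 X : 0 <= Defs.cut G X.
Proof.
by apply: sumr_ge0 => u _; apply: sumr_ge0 => v /andP[_ /weight_gt0/ltW].
Qed.

(** Coarea formula: an ordered pair enters the frustration at the levels below both [F u] and [F v],
    and the cut at those between [F v] and [F u]. *)
Lemma frustration_cut_sum (l : seq (R * R)) (F : V -> R) p :
  (forall u, \sum_(c <- l) c.1 * (c.2 < F u)%R%:R = F u) ->
  \sum_(c <- l) c.1 * (2 * frustration G sigma [set u | c.2 < F u] p +
                       Defs.cut G [set u | c.2 < F u]) =
  \sum_u \sum_(v | adj G u v) weight G u v *
    (Num.min (F u) (F v) * normc (p u - sigma u v * p v) +
     (F u - Num.min (F u) (F v))).
Proof.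
move=> lF.
have lmin u v : \sum_(c <- l) c.1 * ((c.2 < F u) && (c.2 < F v))%R%:R = Num.min (F u) (F v).
  under eq_bigr do rewrite -lt_min.
  by have [/min_l->|/min_r->] := orP (le_total (F u) (F v)).
transitivity (\sum_(c <- l) \sum_u \sum_(v | adj G u v) weight G u v *
    (c.1 * ((c.2 < F u) && (c.2 < F v))%R%:R * normc (p u - sigma u v * p v) +
      (c.1 * (c.2 < F u)%R%:R - c.1 * ((c.2 < F u) && (c.2 < F v))%R%:R))).
  apply: eq_bigr => c _; rewrite /frustration /Defs.cut mulrA divff ?pnatr_eq0// mul1r.
  rewrite big_mkcond [X in _ + X]big_mkcond -big_split mulr_sumr; apply: eq_bigr => u _ /=.
  rewrite inE; case: (c.2 < F u) => /=; last first.
    by rewrite addr0 mulr0 big1// => v _; ring.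
  rewrite (eq_bigl (fun v => (adj G u v) && (c.2 < F v))); last first.
    by move=> v; rewrite inE andbC.
  rewrite [X in _ + X](eq_bigl (fun v => (adj G u v) && ~~ (c.2 < F v))); last first.
    by move=> v; rewrite inE andbC.
  rewrite big_mkcondr [X in _ + X]big_mkcondr -big_split mulr_sumr/=.
  by apply: eq_bigr => v _; case: (c.2 < F v) => /=; ring.
rewrite exchange_big; apply: eq_bigr => u _; rewrite exchange_big; apply: eq_bigr => v _ /=.
by rewrite -mulr_sumr big_split sumrB -mulr_suml lmin lF.
Qed.

Variables (delta c : R).
Hypotheses (hdelta : 1 < delta) (hc : 0 < c).
Hypothesis iso : isoperimetric_dim G Gamma sigma delta c.

(** From [vol X <= nu], [vol X ^ (1 - 1/delta) >= nu ^ (-1/delta) * vol X]; this form is linear in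
    the volume and can be summed over levels. *)
Lemma isoperimetric_faber_krahn X p (nu : R) : (forall u, normc (p u) = 1) ->
  vol G X <= nu ->
  c * nu `^ (- delta^-1) * vol G X <= 2 * frustration G sigma X p + Defs.cut G X.
Proof.
move=> p1 Xnu; have [->|X0] := eqVneq X finset.set0.
  rewrite /vol big_set0 mulr0; apply: addr_ge0; last exact: cut_ge0.
  by apply: mulr_ge0; rewrite ?frustration_ge0.
have volX : 0 < vol G X.
  have /set0Pn[x xX] := X0; rewrite /vol (bigD1 x)//=.
  by rewrite ltr_wpDr ?vmeas_gt0//; apply: sumr_ge0 => u _; exact/ltW/vmeas_gt0.
apply: le_trans (le_trans (iso X0) (lerD (frustration_index_le _ p1) (lexx _))).
have d0 : 0 < delta by rewrite (lt_trans _ hdelta).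
have -> : (delta - 1) / delta = 1 - delta^-1 by rewrite mulrBl divff ?gt_eqF// mul1r.
rewrite powRB ?(gt_eqF volX) ?implybT// powRr1 ?(ltW volX)// powRN -mulrA.
rewrite ler_pM2l// mulrC ler_pM2l// lef_pV2 ?posrE ?powR_gt0//.
  apply: ge0_ler_powR => //; rewrite ?nnegrE ?invr_ge0; [exact: ltW..|].
  by rewrite ltW// (lt_le_trans volX).
exact: lt_le_trans Xnu.
Qed.

Lemma nash_inequality g (M : R) (a := \sum_u vmeas G u * normc (g u) ^+ 2) : 0 < M ->
  \sum_u vmeas G u * normc (g u) <= M -> 0 < a ->
  (c * (2 * M ^+ 2 / a) `^ (- delta^-1)) ^+ 2 * a <=
    128 * (max_deg G + 1) * dirichlet_energy G sigma g.
Proof.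
move=> M0 gM a0; pose s := a / (2 * M); pose nu := 2 * M ^+ 2 / a.
have s0 : 0 < s by rewrite divr_gt0// mulr_gt0.
pose T x : R := Num.max 0 (x ^+ 2 - s ^+ 2).
pose F u := T (normc (g u)); pose p u := phase (g u).
have p1 u : normc (p u) = 1 by exact: normc_phase.
have [|l l0 lF] := @layer_cake _ V F; first by move=> u; rewrite le_max lexx.
(* Chebyshev's inequality: [F u > r >= 0] forces [|g u| > s]. *)
have volF r : 0 <= r -> vol G [set u | r < F u] <= nu.
  move=> r0; apply: (@le_trans _ _ (M / s)); last first.
    by rewrite /nu /s le_eqVlt; apply/orP; left; apply/eqP; field; rewrite !gt_eqF.
  rewrite ler_pdivlMr//; apply: le_trans gM.
  rewrite mulr_suml big_mkcond; apply: ler_sum => u _ /=.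
  have mu0 := vmeas_gt0 G u; rewrite inE.
  case: ltP => [rF|_]; last by rewrite mulr_ge0 ?normc_ge0// ltW.
  rewrite ler_pM2l//; have : 0 < F u by exact: le_lt_trans rF.
  rewrite lt_max ltxx/= subr_gt0; have := normc_ge0 (g u); nra.
(* Here [F >= x^2 - s x] for [x = |g u|], and [s] is chosen so that [a - s M = a / 2]. *)
have sumF : a / 2 <= \sum_u vmeas G u * F u.
  apply: (@le_trans _ _ (a - s * M)).
    by rewrite /s le_eqVlt; apply/orP; left; apply/eqP; field; rewrite !gt_eqF.
  apply: (@le_trans _ _ (\sum_u vmeas G u * (normc (g u) ^+ 2 - s * normc (g u)))).
    rewrite (eq_bigr (fun u => vmeas G u * normc (g u) ^+ 2 - s * (vmeas G u * normc (g u)))).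
      by rewrite sumrB -mulr_sumr lerB// ler_pM2l.
    by move=> u _; ring.
  apply: ler_sum => u _; rewrite ler_pM2l ?vmeas_gt0// /F /T le_max.
  have x0 := normc_ge0 (g u); set x := normc (g u) in x0 *.
  have [xs|sx] := leP x s; apply/orP; [left|right]; nra.
pose H := c * nu `^ (- delta^-1).
have nu0 : 0 < nu by rewrite /nu divr_gt0 ?mulr_gt0 ?exprn_gt0.
have H0 : 0 < H by rewrite mulr_gt0 ?powR_gt0.
have key : H * (a / 2) <= \sum_u \sum_(v | adj G u v) weight G u v *
    (2 * ((normc (g u) + normc (g v)) * normc (g u - sigma u v * g v))).
  apply: (@le_trans _ _ (H * \sum_u vmeas G u * F u)); first by rewrite ler_pM2l.
  apply: (@le_trans _ _ (\sum_(c <- l) c.1 * (H * vol G [set u | c.2 < F u]))).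
    rewrite le_eqVlt; apply/orP; left; apply/eqP.
    rewrite (eq_bigr (fun c => \sum_u H * vmeas G u * (c.1 * (c.2 < F u)%R%:R))).
      rewrite exchange_big/= mulr_sumr; apply: eq_bigr => u _.
      by rewrite -mulr_sumr lF mulrA.
    move=> q _; rewrite mulrA [q.1 * H]mulrC /vol mulr_sumr big_mkcond/=.
    by apply: eq_bigr => u _; rewrite inE; case: ltP => _ /=; ring.
  apply: (@le_trans _ _ (\sum_(c <- l) c.1 *
      (2 * frustration G sigma [set u | c.2 < F u] p + Defs.cut G [set u | c.2 < F u]))).
    rewrite big_seq [leRHS]big_seq; apply: ler_sum => q /l0[q1 q2].
    by rewrite ler_wpM2l// isoperimetric_faber_krahn// volF.
  rewrite frustration_cut_sum//; apply: ler_sum => u _; apply: ler_sum => v uv.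
  rewrite ler_pM2l ?weight_gt0//.
  (* The edge bound is applied with [w = sigma u v * g v], which has the modulus of [g v] and phase
     [sigma u v * p v]. *)
  have suv := normc_signature uv.
  have nsg : normc (sigma u v * g v) = normc (g v) by rewrite Normc.normcM suv mul1r.
  rewrite /F -nsg; apply: truncated_edge_le (fun=> erefl); rewrite ?mul_phase//.
    by rewrite Normc.normcM suv mul1r.
  by rewrite nsg mulrCA mul_phase.
(* Adding one keeps [D] positive on a graph without edges. *)
pose D := max_deg G + 1.
have D0 : 0 < D by rewrite ltr_wpDl ?max_deg_ge0.
have young (e : R) : 0 < e -> H * (a / 2) <=
    e * (4 * max_deg G * a) + 2 * dirichlet_energy G sigma g / e.
  (* Young: [2 (x + y) z <= e (x + y)^2 + z^2 / e <= e (2 x^2 + 2 y^2) + z^2 / e] *)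
  move=> e0; apply: le_trans key _.
  apply: (@le_trans _ _ (\sum_u \sum_(v | adj G u v)
      (e * (weight G u v * (2 * normc (g u) ^+ 2 + 2 * normc (g v) ^+ 2)) +
       e^-1 * (weight G u v * normc (g u - sigma u v * g v) ^+ 2)))).
    apply: ler_sum => u _; apply: ler_sum => v uv.
    set x := normc (g u); set y := normc (g v); set z := normc _.
    rewrite [e * (_ * _)]mulrCA [e^-1 * _]mulrCA -mulrDr ler_pM2l ?weight_gt0//.
    have e1 : e * e^-1 = 1 by rewrite divff ?gt_eqF.
    have := sqr_ge0 (e * (x + y) - z); have := sqr_ge0 (x - y).
    rewrite -(ler_pM2l e0) => h1 h2.
    have -> : e * (e * (2 * x ^+ 2 + 2 * y ^+ 2) + e^-1 * z ^+ 2) =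
       e ^+ 2 * (2 * x ^+ 2 + 2 * y ^+ 2) + (e * e^-1) * z ^+ 2 by ring.
    rewrite e1 mul1r.
    have := ler_wpM2l (sqr_ge0 e) h1; nra.
  under eq_bigr do rewrite big_split -!mulr_sumr/=.
  rewrite big_split -!mulr_sumr/=; apply: lerD; last first.
    by rewrite /dirichlet_energy mulrA divff ?pnatr_eq0// mul1r mulrC.
  rewrite ler_pM2l//.
  have sw : \sum_u \sum_(v | adj G u v) weight G u v * normc (g u) ^+ 2 <= max_deg G * a.
    rewrite /a mulr_sumr; apply: ler_sum => u _; rewrite -mulr_suml mulrA.
    by rewrite ler_wpM2r ?sqr_ge0// wdeg_le.
  have sw' : \sum_u \sum_(v | adj G u v) weight G u v * normc (g v) ^+ 2 =
      \sum_u \sum_(v | adj G u v) weight G u v * normc (g u) ^+ 2.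
    under eq_bigr do rewrite big_mkcond.
    rewrite exchange_big; apply: eq_bigr => u _ /=; rewrite [RHS]big_mkcond.
    by apply: eq_bigr => v _; rewrite adj_sym weight_sym.
  under eq_bigr do (under eq_bigr do rewrite mulrDr [_ * (2 * _)]mulrCA [X in _ + X]mulrCA;
    rewrite big_split -!mulr_sumr/=).
  by rewrite big_split -!mulr_sumr/= sw'; lra.
(* This [e] makes the degree term at most [H * a / 4], half of the left-hand side, so that it can be
   absorbed. *)
have e0 : 0 < H / (16 * D) by apply: divr_gt0 => //; exact: mulr_gt0.
have := young _ e0; set E := dirichlet_energy _ _ _ => h.
have h1 : H / (16 * D) * (4 * max_deg G * a) <= H * (a / 4).
  have -> : H * (a / 4) = H / (16 * D) * (4 * D * a) by field; rewrite gt_eqF.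
  by rewrite ler_pM2l// ler_pM2r// ler_pM2l// lerDl.
have h2 : H * (a / 4) <= 2 * E / (H / (16 * D)) by lra.
have h3 : 2 * E / (H / (16 * D)) = 32 * D * E / H by field; rewrite !gt_eqF.
rewrite h3 ler_pdivlMr// in h2; rewrite -/nu -/H -/D; lra.
Qed.

End MagneticNash.

(** * One step of the backward Euler scheme *)

Section Resolvent.
Variables (R : realType) (V : finType) (G : wgraph R V).
Variables (Gamma : set R[i]) (sigma : V -> V -> R[i]).
Local Notation normc := (@Normc.normc R).
Implicit Types (g h : V -> R[i]).

Hypothesis GammaP : Gamma = unit_circle R
  \/ (exists2 k : nat, (0 < k)%N & Gamma = cyclic_circle R k).
Hypothesis sig : signature G Gamma sigma.

(** The real part of [z * conjc w]. *)
Definition rdot (z w : R[i]) : R := complex.Re z * complex.Re w + complex.Im z * complex.Im w.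

Lemma rdotDr z w1 w2 : rdot z (w1 + w2) = rdot z w1 + rdot z w2.
Proof. by case: z w1 w2 => [a b] [c d] [e f]; rewrite /rdot/=; ring. Qed.

Lemma rdot0r z : rdot z 0 = 0.
Proof. by rewrite /rdot/= !mulr0 addr0. Qed.

Lemma rdotZr z (x : R) w : rdot z (x%:C * w) = x * rdot z w.
Proof. by case: z w => [a b] [c d]; rewrite /rdot/=; ring. Qed.

Lemma rdot_sumr z (P : pred V) (F : V -> R[i]) :
  rdot z (\sum_(v | P v) F v) = \sum_(v | P v) rdot z (F v).
Proof. by apply: (big_morph (rdot z)) => [x y|]; [exact: rdotDr|exact: rdot0r]. Qed.

Lemma normc_sqr z : normc z ^+ 2 = rdot z z.
Proof.
by case: z => a b; rewrite /rdot/= sqr_sqrtr ?addr_ge0 ?sqr_ge0// !expr2.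
Qed.

Lemma normc_sqrD z w : normc (z + w) ^+ 2 = normc z ^+ 2 + 2 * rdot z w + normc w ^+ 2.
Proof. by rewrite !normc_sqr /rdot; case: z w => [a b] [c d] /=; ring. Qed.

(* [s^-1] is the conjugate of [s], the signature of the reversed edge. *)
Lemma rdot_magnetic z w s : normc s = 1 ->
  rdot z (z - s * w) + rdot w (w - s^-1 * z) = normc (z - s * w) ^+ 2.
Proof.
move=> /(congr1 (fun x => x ^+ 2)); rewrite !normc_sqr /rdot expr1n.
case: s z w => [p q] [a b] [c d] /= => pq.
rewrite -!expr2 in pq *; rewrite pq !divr1.
have -> : (a - (p * c - q * d)) ^+ 2 + (b - (p * d + q * c)) ^+ 2 =
  a ^+ 2 + b ^+ 2 + (p ^+ 2 + q ^+ 2) * (c ^+ 2 + d ^+ 2)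
  - 2 * a * (p * c - q * d) - 2 * b * (p * d + q * c) by ring.
rewrite pq; ring.
Qed.

Lemma normc_sum (P : pred V) (F : V -> R[i]) :
  normc (\sum_(v | P v) F v) <= \sum_(v | P v) normc (F v).
Proof.
apply: (big_ind2 (fun z x => normc z <= x)) => //; first by rewrite Normc.normc0.
by move=> z x w y zx wy; apply: le_trans (le_normcD _ _) _; exact: lerD.
Qed.

Lemma normcZ (x : R) z : 0 <= x -> normc (x%:C * z) = x * normc z.
Proof. by move=> x0; rewrite Normc.normcM normc_real. Qed.

(* With [g = f / sqrt mu], [flow g u] is [sqrt (mu u) * Delta f u]. *)
Definition flow g u : R[i] :=
  \sum_(v | adj G u v) (weight G u v)%:C * (g u - sigma u v * g v).

Lemma exchange_adj (F : V -> V -> R) :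
  \sum_u \sum_(v | adj G u v) F u v = \sum_u \sum_(v | adj G u v) F v u.
Proof.
under eq_bigr do rewrite big_mkcond.
rewrite exchange_big; apply: eq_bigr => u _ /=; rewrite [RHS]big_mkcond.
by apply: eq_bigr => v _; rewrite adj_sym.
Qed.

(** Green's formula: adding the two orientations of an edge gives a square by [rdot_magnetic]. *)
Lemma sum_rdot_flow g : \sum_u rdot (g u) (flow g u) = dirichlet_energy G sigma g.
Proof.
transitivity (\sum_u \sum_(v | adj G u v)
    weight G u v * rdot (g u) (g u - sigma u v * g v)).
  apply: eq_bigr => u _; rewrite rdot_sumr; apply: eq_bigr => v _; exact: rdotZr.
set S := LHS; have : S + S = 2 * dirichlet_energy G sigma g; last by lra.
rewrite {2}/S exchange_adj /dirichlet_energy mulrA divff ?pnatr_eq0// mul1r.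
rewrite -big_split; apply: eq_bigr => u _; rewrite -big_split; apply: eq_bigr => v uv /=.
rewrite [weight G v u]weight_sym -mulrDr (proj2 (sig uv)) rdot_magnetic//.
exact (normc_signature GammaP sig uv).
Qed.

Lemma dirichlet_energy_ge0 g : 0 <= dirichlet_energy G sigma g.
Proof.
rewrite mulr_ge0 ?invr_ge0//; apply: sumr_ge0 => u _; apply: sumr_ge0 => v uv.
by rewrite mulr_ge0 ?sqr_ge0// ltW// weight_gt0.
Qed.

Variables (s : R) (g h : V -> R[i]).
Hypothesis s0 : 0 <= s.
(** In terms of [f = sqrt mu * g], this says that [1 + s Delta] maps the function of [g] to that of
    [h]. *)
Hypothesis step : forall u,
  (vmeas G u)%:C * h u = (vmeas G u)%:C * g u + s%:C * flow g u.

(** The diagonal part of [flow] is moved to the left and moduli are taken. Summed over [u], the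
    degree terms on both sides cancel because the weights are symmetric. *)
Lemma resolvent_L1_le : \sum_u vmeas G u * normc (g u) <= \sum_u vmeas G u * normc (h u).
Proof.
have loc u : vmeas G u * normc (g u) + s * (wdeg G u * normc (g u)) <=
    vmeas G u * normc (h u) + s * \sum_(v | adj G u v) weight G u v * normc (g v).
  have mu0 := ltW (vmeas_gt0 G u).
  have d0 : 0 <= wdeg G u by apply: sumr_ge0 => v /weight_gt0/ltW.
  have flowE : flow g u = (wdeg G u)%:C * g u -
      \sum_(v | adj G u v) (weight G u v)%:C * (sigma u v * g v).
    rewrite /flow /wdeg rmorph_sum mulr_suml -sumrB/=.
    by apply: eq_bigr => v _; rewrite mulrBr.
  have -> : vmeas G u * normc (g u) + s * (wdeg G u * normc (g u)) =
      normc ((vmeas G u)%:C * h u +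
        s%:C * \sum_(v | adj G u v) (weight G u v)%:C * (sigma u v * g v)).
    set S := \sum_(v | _) _ in flowE *; rewrite step flowE.
    have -> : (vmeas G u)%:C * g u + s%:C * ((wdeg G u)%:C * g u - S) + s%:C * S =
      (vmeas G u + s * wdeg G u)%:C * g u by rewrite rmorphD rmorphM/=; ring.
    by rewrite normcZ ?addr_ge0 ?mulr_ge0// mulrDl mulrA.
  apply: le_trans (le_normcD _ _) _; rewrite !normcZ// lerD2l ler_wpM2l//.
  apply: le_trans (normc_sum _ _) _; apply: ler_sum => v uv.
  rewrite normcZ ?(ltW (weight_gt0 uv))// Normc.normcM.
  by rewrite (normc_signature GammaP sig uv) mul1r.
have := ler_sum (index_enum V) (fun u _ => loc u) : _.
move=> /(_ (fun _ => true)); rewrite !big_split -!mulr_sumr/=.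
have -> : \sum_u wdeg G u * normc (g u) =
    \sum_u \sum_(v | adj G u v) weight G u v * normc (g v).
  rewrite exchange_adj; apply: eq_bigr => u _; rewrite /wdeg mulr_suml.
  by apply: eq_bigr => v _; rewrite weight_sym.
by rewrite lerD2r.
Qed.

(** Expanding [|g + (s / mu) flow g|^2], the cross terms sum to [2 s] times the energy and the last
    square is dropped. *)
Lemma resolvent_L2_le :
  \sum_u vmeas G u * normc (g u) ^+ 2 + 2 * s * dirichlet_energy G sigma g <=
  \sum_u vmeas G u * normc (h u) ^+ 2.
Proof.
rewrite -sum_rdot_flow mulr_sumr -big_split/=; apply: ler_sum => u _.
have mu0 := vmeas_gt0 G u.
have -> : h u = g u + (s / vmeas G u)%:C * flow g u.
  have mu1 : (vmeas G u)%:C != 0.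
    by apply/eqP => /complexI mu1; rewrite mu1 ltxx in mu0.
  apply: (mulfI mu1); rewrite step mulrDr mulrA -rmorphM; congr (_ + _%:C * _).
  by field; rewrite gt_eqF.
rewrite normc_sqrD rdotZr; move: (rdot _ _) => r; rewrite !mulrDr.
have -> : vmeas G u * (2 * (s / vmeas G u * r)) =
  2 * s * r by field; rewrite gt_eqF.
by rewrite lerDl mulr_ge0 ?sqr_ge0// ltW.
Qed.

End Resolvent.

(** * Decay of the backward Euler scheme for an ordinary differential inequality *)

Section BackwardEuler.
Variable R : realType.

(** A convex power lies below its chord over [[0, 1]]. *)
Lemma exprD1_le (x : R) n : 0 <= x <= 1 -> (1 + x) ^+ n <= 1 + (2 ^+ n - 1) * x.
Proof.
move=> /andP[x0 x1]; elim: n => [|n IHn]; first by rewrite !expr0 subrr mul0r addr0.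
rewrite !exprS; have : 1 <= 2 ^+ n :> R by rewrite exprn_ege1// ler1n.
set y := (1 + x) ^+ n in IHn *; set z := 2 ^+ n in IHn * => z1.
have x2 : (z - 1) * (x * x) <= (z - 1) * x.
  by apply: ler_wpM2l; [lra|rewrite ler_piMr].
have x10 : 0 <= 1 + x by lra.
by have := ler_wpM2l x10 IHn; lra.
Qed.

(** Discrete comparison for [b' = - A b^(1 + 1/q)]. If [b k.+1] exceeded the claimed value [y], the
    step inequality would put [b k] above [y (1 + A s y^(1/q))]. The choice of [K] turns this into
    [y (1 + 2^(n+1) / (k+2))], which is at least the bound already known for [b k]. *)
Lemma backward_euler_decay (A q s : R) (n : nat) (b : nat -> R)
    (K := (2 ^+ n.+1 / A) `^ q) :
  0 < A -> 0 < q -> q <= n%:R -> 0 < s -> (forall k, 0 <= b k) ->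
  (forall k, b k.+1 + A * s * (b k.+1 * b k.+1 `^ q^-1) <= b k) ->
  b 0 <= K * s `^ (- q) ->
  forall k, b k <= K * (k.+1%:R * s) `^ (- q).
Proof.
move=> A0 q0 qn s0 b0 bS b0K; elim=> [|k IHk]; first by rewrite mul1r.
have k1 : 0 < k.+1%:R :> R by rewrite ltr0n.
have k2 : 0 < k.+2%:R :> R by rewrite ltr0n.
have kk : k.+2%:R = k.+1%:R + 1 :> R by rewrite natr1.
have B0 : 0 < 2 ^+ n.+1 / A by rewrite divr_gt0 ?exprn_gt0.
pose y := K * (k.+2%:R * s) `^ (- q).
have K0 : 0 < K by rewrite /K powR_gt0.
have y0 : 0 < y by rewrite /y mulr_gt0// powR_gt0// mulr_gt0.
rewrite leNgt -/y; apply/negP => yb.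
have yq : y `^ q^-1 = 2 ^+ n.+1 / A / (k.+2%:R * s).
  rewrite /y powRM ?powR_ge0// /K -!powRrM mulNr divff ?gt_eqF//.
  by rewrite powRr1 ?powR_inv1// ?ltW// mulr_gt0.
have ybq : y `^ q^-1 <= b k.+1 `^ q^-1.
  by apply: ge0_ler_powR; rewrite ?nnegrE ?invr_ge0 ?b0//; exact: ltW.
have yk : K * (k.+1%:R * s) `^ (- q) = y * (1 + k.+1%:R^-1) `^ q.
  have -> : 1 + k.+1%:R^-1 = k.+2%:R / k.+1%:R :> R by rewrite kk; field; rewrite gt_eqF.
  rewrite /y !powRN !powRM ?invr_ge0 ?(ltW k1) ?(ltW k2) ?(ltW s0)//.
  rewrite -[k.+1%:R^-1]powR_inv1 ?(ltW k1)// -powRrM mulN1r powRN.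
  by field; rewrite !gt_eqF ?powR_gt0.
(* After raising the exponent to [n], [exprD1_le] and [k + 2 <= 2 (k + 1)] account for the extra
   power of two. *)
have pow_le : (1 + k.+1%:R^-1) `^ q <= 1 + 2 ^+ n.+1 / k.+2%:R :> R.
  have i0 : 0 <= k.+1%:R^-1 :> R by rewrite invr_ge0 ltW.
  apply: (@le_trans _ _ ((1 + k.+1%:R^-1) `^ n%:R)).
    by rewrite ler_powR// lerDl.
  rewrite powR_mulrn ?addr_ge0//.
  apply: le_trans (exprD1_le _ _) _; first by rewrite i0 invf_le1// ler1n.
  rewrite lerD2l ler_pdivrMr// mulrAC ler_pdivlMr// exprS.
  have z0 : 0 < 2 ^+ n :> R by rewrite exprn_gt0.
  set z := 2 ^+ n in z0 *; rewrite kk; have : 1 <= k.+1%:R :> R by rewrite ler1n.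
  set x := k.+1%:R; nra.
have := bS k; rewrite leNgt => /negP; apply.
apply: le_lt_trans IHk _; rewrite yk.
apply: le_lt_trans (_ : _ <= y * (1 + 2 ^+ n.+1 / k.+2%:R)) _.
  by rewrite ler_pM2l.
have -> : y * (1 + 2 ^+ n.+1 / k.+2%:R) = y + A * s * (y * y `^ q^-1).
  by rewrite yq; field; rewrite !gt_eqF.
apply: ltr_leD => //; rewrite ler_pM2l ?mulr_gt0//.
by apply: ler_pM => //; [exact: ltW|exact: powR_ge0|exact: ltW].
Qed.

End BackwardEuler.

(** * Orthonormal eigenbasis *)

Lemma spectralmx_mul (C : numClosedFieldType) n (A : 'M[C]_n) :
  A \is normalmx -> spectralmx A *m A = diag_mx (spectral_diag A) *m spectralmx A.
Proof.
move=> /orthomx_spectralP AE.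
by rewrite {2}AE !mulmxA mulmxV ?spectral_unit// mul1mx.
Qed.

Section Spectrum.
Variables (R : realType) (V : finType) (G : wgraph R V).
Variables (Gamma : set R[i]) (sigma : V -> V -> R[i]).
Local Notation normc := (@Normc.normc R).
Local Notation Delta := (magnetic_laplacian G sigma).
Local Notation C := R[i].
Local Notation fun_space := {ffun V -> C^o}.

Hypothesis GammaP : Gamma = unit_circle R
  \/ (exists2 k : nat, (0 < k)%N & Gamma = cyclic_circle R k).
Hypothesis sig : signature G Gamma sigma.

Lemma conjCE (z : C) : Num.conj z = conjc z.
Proof. by []. Qed.

Definition dirac_ffun (a : V) : fun_space := [ffun v => (v == a)%:R].

Lemma laplacian_dirac a b : Delta (dirac_ffun a) b =
  (Num.sqrt (vmeas G b))%:C^-1 * (Num.sqrt (vmeas G a))%:C^-1 *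
  ((a == b)%:R * (wdeg G b)%:C - (adj G b a)%:R * ((weight G b a)%:C * sigma b a)).
Proof.
rewrite ffunE -mulrA; congr (_ * _).
rewrite (eq_bigr (fun v => (weight G b v)%:C * ((b == a)%:R / (Num.sqrt (vmeas G b))%:C)
   - (v == a)%:R * ((weight G b v)%:C * sigma b v / (Num.sqrt (vmeas G v))%:C))); last first.
  by move=> v _; rewrite !ffunE; ring.
rewrite sumrB mulrBr; congr (_ - _).
  rewrite -mulr_suml /wdeg rmorph_sum/= eq_sym.
  by have [->|_] := eqVneq; [ring|rewrite !(mul0r, mulr0)].
have [ba|ba] := boolP (adj G b a).
  rewrite (bigD1 a)//= eqxx big1 ?addr0; last by move=> v /andP[_ /negPf->]; rewrite mul0r.
  by rewrite !mul1r mulrC.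
rewrite mul0r mulr0 big1// => v bv; case: eqP => [va|_]; last by rewrite mul0r.
by rewrite va (negPf ba) in bv.
Qed.

Lemma signatureJ u v : adj G u v -> sigma v u = conjc (sigma u v).
Proof.
move=> uv; rewrite (proj2 (sig uv)) invc_norm normc_def.
have := normc_signature GammaP sig uv; case: (sigma u v) => a b /= ->.
by rewrite expr1n invr1 mul1r.
Qed.

(** Row [i] is the image of the [i]-th Dirac function, so the matrix acts on row vectors from the
    right. *)
Definition laplacian_mx : 'M[C]_#|V| :=
  \matrix_(i, j) Delta (dirac_ffun (enum_val i)) (enum_val j).

Lemma laplacian_mx_hermsym : laplacian_mx \is hermsymmx.
Proof.
apply/is_hermitianmxP; rewrite expr0 scale1r; apply/matrixP => i j.
rewrite !mxE !laplacian_dirac conjCE.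
set a := enum_val i; set b := enum_val j.
have cM (x y : C) : conjc (x * y) = conjc x * conjc y by exact: rmorphM.
have cB (x y : C) : conjc (x - y) = conjc x - conjc y by exact: rmorphB.
rewrite !(cM, cB, conjc_inv, conjc_real, conjc_nat).
rewrite [X in X * _ = _]mulrC; congr (_ * (_ - _)).
  by rewrite eq_sym; have [->|_] := eqVneq; rewrite ?mul0r.
rewrite adj_sym; have [ab|_] := boolP (adj G a b); last by rewrite !mul0r.
by rewrite weight_sym (signatureJ ab).
Qed.

Lemma laplacian_mx_mul (r : 'rV[C]_#|V|) j :
  (r *m laplacian_mx) 0 j = Delta [ffun v => r 0 (enum_rank v)] (enum_val j).
Proof.
set f : fun_space := [ffun v => _].
have -> : f = \sum_(i < #|V|) r 0 i *: dirac_ffun (enum_val i).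
  apply/ffunP => v; rewrite sum_ffunE (bigD1 (enum_rank v))//= big1 ?addr0.
    by rewrite !ffunE enum_rankK eqxx [RHS]mulr1.
  move=> i iv; rewrite !ffunE; case: eqP => [vi|_]; last exact: mulr0.
  by rewrite vi enum_valK eqxx in iv.
rewrite linear_sum sum_ffunE !mxE; apply: eq_bigr => i _.
by rewrite linearZ ffunE mxE.
Qed.

(** The [phi j] are the rows of a unitary diagonalising matrix [P]: orthonormality says that [P]
    times its adjoint is the identity, completeness is the product in the other order. *)
Lemma orthonormal_eigenbasis : exists (D : 'I_#|V| -> R) (phi : 'I_#|V| -> fun_space),
  [/\ forall j, Delta (phi j) = (D j)%:C *: phi j,
      forall i j, \sum_v phi i v * conjc (phi j v) = (i == j)%:R &
      forall u v, \sum_j conjc (phi j u) * phi j v = (u == v)%:R].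
Proof.
pose A := laplacian_mx; pose P := spectralmx A.
have Ah := laplacian_mx_hermsym.
have PA : P *m A = diag_mx (spectral_diag A) *m P.
  exact/spectralmx_mul/hermitian_normalmx.
have PU : P \is unitarymx := spectral_unitarymx A.
have /unitarymxP PP := PU.
have PP' := mulmx1C PP.
exists (fun j => complex.Re (spectral_diag A 0 j)).
exists (fun j => [ffun v => P j (enum_rank v)]); split.
- move=> j; apply/ffunP => v.
  have := congr1 (fun X : 'M_#|V| => X j (enum_rank v)) PA.
  have -> : (P *m A) j (enum_rank v) = (row j P *m A) 0 (enum_rank v).
    by rewrite -row_mul [RHS]mxE.
  rewrite laplacian_mx_mul enum_rankK mul_diag_mx mxE => E.
  rewrite [RHS]ffunE [X in _ = _ *: X]ffunE RRe_real; last first.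
    have /mxOverP := hermitian_spectral_diag_real Ah; exact.
  by rewrite -[RHS]E; congr (magnetic_laplacian _ _ _ _); apply/ffunP => u; rewrite !ffunE mxE.
- move=> i j; have := congr1 (fun X : 'M_#|V| => X i j) PP; rewrite !mxE => <-.
  rewrite (reindex (@enum_val V predT))/=; last by apply: onW_bij; exact: enum_val_bij.
  by apply: eq_bigr => k _; rewrite !ffunE !mxE enum_valK.
- move=> u v; have := congr1 (fun X : 'M_#|V| => X (enum_rank u) (enum_rank v)) PP'.
  rewrite !mxE (inj_eq enum_rank_inj) => <-.
  by apply: eq_bigr => k _; rewrite !ffunE !mxE.
Qed.

(** The [phi j] with [D j = a] are free in the eigenspace of [a], so no multiplicity in [D] exceeds
    the one in [lam]. Both lists have [#|V|] entries, so all multiplicities agree. *)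
Lemma spectrum_perm (D : 'I_#|V| -> R) (phi : 'I_#|V| -> fun_space)
    (lam : #|V|.-tuple R) :
  (forall j, Delta (phi j) = (D j)%:C *: phi j) ->
  (forall i j, \sum_v phi i v * conjc (phi j v) = (i == j)%:R) ->
  is_spectrum G sigma lam -> perm_eq [seq D j | j <- enum 'I_#|V|] lam.
Proof.
move=> phiE ortho [_ lamE].
have phi_free : free [seq phi j | j <- enum 'I_#|V|].
  have -> : [seq phi j | j <- enum 'I_#|V|] = [tuple phi j | j < #|V|] by [].
  apply/freeP => k k0 i.
  have := congr1 (fun f : fun_space => \sum_v f v * conjc (phi i v)) k0.
  rewrite [RHS]big1; last by move=> v _; rewrite ffunE mul0r.
  rewrite (eq_bigr (fun v => \sum_(j < #|V|) k j * (phi j v * conjc (phi i v)))); last first.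
    move=> v _; rewrite sum_ffunE mulr_suml; apply: eq_bigr => j _.
    by rewrite -tnth_nth tnth_mktuple ffunE mulrA.
  rewrite exchange_big (bigD1 i)//= -mulr_sumr ortho eqxx mulr1 big1 ?addr0//.
  by move=> j /negPf ji; rewrite -mulr_sumr ortho ji mulr0.
have [|s slam Ds] := (count_subseqP [seq D j | j <- enum 'I_#|V|] lam).1.
  move=> a; rewrite lamE count_map.
  pose sa := [seq phi j | j <- enum 'I_#|V| & D j == a].
  have sa_free : free sa.
    have /permPl pe := perm_filterC (fun j => D j == a) (enum 'I_#|V|).
    have := perm_free (perm_map phi pe).
    by rewrite phi_free map_cat => /catl_free.
  have -> : count (preim D (pred1 a)) (enum 'I_#|V|) = size sa.
    by rewrite size_map size_filter.
  rewrite -(eqP sa_free); apply: dimvS; apply/span_subvP => f /mapP[j].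
  rewrite mem_filter => /andP[/eqP ja _] ->.
  rewrite /passmx.leigenspace memv_ker.
  rewrite add_lfunE opp_lfunE scale_lfunE id_lfunE lfunE/= phiE ja.
  by rewrite subrr.
have := size_subseq_leqif slam.
rewrite size_tuple -(perm_size Ds) size_map size_enum_ord => -[_].
by rewrite eqxx => /esym/eqP <-.
Qed.

End Spectrum.

(** * Iterates of a point mass *)

Section HeatTrace.
Variables (R : realType) (V : finType) (G : wgraph R V).
Variables (Gamma : set R[i]) (sigma : V -> V -> R[i]).
Local Notation normc := (@Normc.normc R).
Local Notation N := #|V|.

Hypothesis GammaP : Gamma = unit_circle R
  \/ (exists2 k : nat, (0 < k)%N & Gamma = cyclic_circle R k).
Hypothesis sig : signature G Gamma sigma.
Variables (D : 'I_N -> R) (phi : 'I_N -> {ffun V -> R[i]^o}).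
Hypothesis phiE : forall j, magnetic_laplacian G sigma (phi j) = (D j)%:C *: phi j.
Hypothesis phi_ortho : forall i j, \sum_v phi i v * conjc (phi j v) = (i == j)%:R.
Hypothesis phi_complete : forall u v, \sum_j conjc (phi j u) * phi j v = (u == v)%:R.

Local Notation smu u := (Num.sqrt (vmeas G u)).
Definition rescaled (f : V -> R[i]) u : R[i] := f u / (smu u)%:C.

Lemma sqrt_vmeas_gt0 u : 0 < smu u.
Proof. by rewrite sqrtr_gt0 vmeas_gt0. Qed.

Lemma sqrt_vmeasC_neq0 u : (smu u)%:C != 0.
Proof. by apply/eqP => /complexI h; have := sqrt_vmeas_gt0 u; rewrite h ltxx. Qed.

Lemma vmeasC u : (vmeas G u)%:C = (smu u)%:C * (smu u)%:C.
Proof. by rewrite -rmorphM -expr2 sqr_sqrtr// ltW// vmeas_gt0. Qed.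

Lemma normc_rescaled f u : normc (rescaled f u) = normc (f u) / smu u.
Proof.
by rewrite Normc.normcM Normc.normcV normc_real// ltW// sqrt_vmeas_gt0.
Qed.

Lemma vmeas_normc_rescaled f u :
  vmeas G u * normc (rescaled f u) ^+ 2 = normc (f u) ^+ 2.
Proof.
rewrite normc_rescaled expr_div_n sqr_sqrtr ?ltW ?vmeas_gt0//.
by rewrite mulrC divfK// gt_eqF// vmeas_gt0.
Qed.

Lemma flow_rescaled_eigen j u :
  flow G sigma (rescaled (phi j)) u =
  (D j * vmeas G u)%:C * rescaled (phi j) u.
Proof.
have := congr1 (fun f : {ffun V -> R[i]^o} => (smu u)%:C * f u) (phiE j).
rewrite /= !ffunE mulrA mulfV ?sqrt_vmeasC_neq0// mul1r => h.
rewrite -[LHS]/(\sum_(v | adj G u v) (weight G u v)%:C *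
  (phi j u / (smu u)%:C - sigma u v * (phi j v / (smu v)%:C))) h.
have -> : (D j * vmeas G u)%:C = (D j)%:C * ((smu u)%:C * (smu u)%:C).
  by rewrite -vmeasC -rmorphM.
rewrite /rescaled -[_ *: _]/(_ * _).
by field; exact: sqrt_vmeasC_neq0.
Qed.

(** [D j] is the Dirichlet energy of a normalised eigenfunction. *)
Lemma eigenvalue_ge0 j : 0 <= D j.
Proof.
have := dirichlet_energy_ge0 G sigma (rescaled (phi j)).
rewrite -(sum_rdot_flow GammaP sig).
under eq_bigr do rewrite flow_rescaled_eigen rdotZr -normc_sqr -mulrA vmeas_normc_rescaled.
rewrite -mulr_sumr.
have -> : \sum_u normc (phi j u) ^+ 2 = 1; last by rewrite mulr1.
apply: complexI; rewrite rmorph_sum/=.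
transitivity ((j == j)%:R : R[i]); last by rewrite eqxx.
by rewrite -phi_ortho; apply: eq_bigr => u _; rewrite rmorphXn -sqr_normc.
Qed.

Section Step.
Variable s : R.
Hypothesis s0 : 0 < s.

Definition resolvent_coef k j : R := (1 + s * D j) ^- k.

(** The power [(1 + s Delta)^-k] applied to the point mass at [x], written in the eigenbasis. *)
Definition resolvent_iter x k (v : V) : R[i] :=
  \sum_j (resolvent_coef k j)%:C * (conjc (phi j x) * phi j v).

Lemma resolvent_coef_step k j :
  resolvent_coef k j = resolvent_coef k.+1 j * (1 + s * D j).
Proof.
rewrite /resolvent_coef exprS invfM mulrAC mulVf ?mul1r// gt_eqF//.
by rewrite ltr_pwDl// mulr_ge0 ?eigenvalue_ge0// ltW.
Qed.

Lemma rescaled_iterE x k v : rescaled (resolvent_iter x k) v =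
  \sum_j (resolvent_coef k j)%:C * (conjc (phi j x) * rescaled (phi j) v).
Proof.
by rewrite /rescaled mulr_suml; apply: eq_bigr => j _; rewrite !mulrA.
Qed.

Lemma flow_iter x k u : flow G sigma (rescaled (resolvent_iter x k)) u =
  \sum_j (resolvent_coef k j)%:C * (conjc (phi j x) * flow G sigma (rescaled (phi j)) u).
Proof.
rewrite /flow.
transitivity (\sum_(v | adj G u v) \sum_j (weight G u v)%:C *
    ((resolvent_coef k j)%:C * (conjc (phi j x) * rescaled (phi j) u) -
     sigma u v * ((resolvent_coef k j)%:C * (conjc (phi j x) * rescaled (phi j) v)))).
  apply: eq_bigr => v _.
  by rewrite !rescaled_iterE [sigma u v * _]mulr_sumr -sumrB mulr_sumr.
rewrite exchange_big; apply: eq_bigr => j _ /=; rewrite !mulr_sumr.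
by apply: eq_bigr => v _; ring.
Qed.

Lemma iter_step x k u :
  (vmeas G u)%:C * rescaled (resolvent_iter x k) u =
  (vmeas G u)%:C * rescaled (resolvent_iter x k.+1) u +
    s%:C * flow G sigma (rescaled (resolvent_iter x k.+1)) u.
Proof.
rewrite flow_iter !rescaled_iterE !mulr_sumr -big_split; apply: eq_bigr => j _ /=.
rewrite flow_rescaled_eigen (resolvent_coef_step k) !rmorphM rmorphD rmorph1 rmorphM /=.
by ring.
Qed.

Lemma iter0E x v : resolvent_iter x 0 v = (x == v)%:R.
Proof.
rewrite -phi_complete; apply: eq_bigr => j _.
by rewrite /resolvent_coef expr0 invr1 mul1r.
Qed.

(** The norm does not increase along the scheme, and initially it is [mu x / sqrt (mu x)]. *)
Lemma iter_L1 x k :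
  \sum_v vmeas G v * normc (rescaled (resolvent_iter x k) v) <= smu x.
Proof.
elim: k => [|k]; last first.
  exact/le_trans/(resolvent_L1_le GammaP sig (ltW s0) (iter_step x k)).
rewrite (bigD1 x)//= normc_rescaled iter0E eqxx Normc.normc1 big1 ?addr0.
  rewrite mul1r -{1}(sqr_sqrtr (ltW (vmeas_gt0 G x))) expr2 mulfK//.
  by rewrite gt_eqF// sqrt_vmeas_gt0.
move=> v vx; rewrite normc_rescaled iter0E eq_sym (negPf vx) Normc.normc0.
by rewrite mul0r mulr0.
Qed.

Definition iter_mass x k : R := \sum_v normc (resolvent_iter x k v) ^+ 2.

Lemma iter_mass_step x k :
  iter_mass x k.+1 +
    2 * s * dirichlet_energy G sigma (rescaled (resolvent_iter x k.+1)) <=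
  iter_mass x k.
Proof.
have := resolvent_L2_le GammaP sig (iter_step x k).
by under eq_bigr do rewrite vmeas_normc_rescaled;
  under [leRHS]eq_bigr do rewrite vmeas_normc_rescaled.
Qed.

Lemma iter_mass0 x : iter_mass x 0 = 1.
Proof.
rewrite /iter_mass (bigD1 x)//= iter0E eqxx Normc.normc1 expr1n big1 ?addr0//.
by move=> v vx; rewrite iter0E eq_sym (negPf vx) Normc.normc0 expr0n.
Qed.

(** The squared Hilbert-Schmidt norm of [(1 + s Delta)^-k]: orthonormality collapses the sum over
    [v], then the one over [x]. *)
Lemma sum_iter_mass k : \sum_x iter_mass x k = \sum_j resolvent_coef k j ^+ 2.
Proof.
apply: complexI; rewrite !rmorph_sum/=.
transitivity (\sum_x \sum_v \sum_i \sum_j ((resolvent_coef k i)%:C * (resolvent_coef k j)%:C *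
   ((phi j x * conjc (phi i x)) * (phi i v * conjc (phi j v))))).
  apply: eq_bigr => x _; rewrite rmorph_sum; apply: eq_bigr => v _.
  rewrite rmorphXn /= -[LHS]/(`|resolvent_iter x k v| ^+ 2) sqr_normc.
  rewrite /resolvent_iter rmorph_sum mulr_suml; apply: eq_bigr => i _.
  rewrite mulr_sumr; apply: eq_bigr => j _.
  have cM (y z : R[i]) : conjc (y * z) = conjc y * conjc z by exact: rmorphM.
  by rewrite /= !cM conjcK conjc_real; ring.
rewrite (eq_bigr (fun x => \sum_i \sum_j (resolvent_coef k i)%:C * (resolvent_coef k j)%:C *
   ((phi j x * conjc (phi i x)) * (i == j)%:R))); last first.
  move=> x _; rewrite exchange_big; apply: eq_bigr => i _.
  rewrite exchange_big; apply: eq_bigr => j _ /=.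
  by rewrite -!mulr_sumr phi_ortho.
rewrite exchange_big; apply: eq_bigr => i _ /=.
rewrite exchange_big (bigD1 i)//= [X in _ + X]big1 ?addr0; last first.
  move=> j /negPf ji; rewrite big1// => x _.
  by rewrite eq_sym ji !mulr0.
under eq_bigr do rewrite eqxx mulr1.
by rewrite -mulr_sumr phi_ortho eqxx mulr1 -rmorphM -expr2.
Qed.

End Step.
End HeatTrace.

(** * Heat trace *)

(** The Nash constant [128] is halved because a step dissipates twice the energy. *)
Definition decay_rate (R : realType) (c d : R) : R := c ^+ 2 / (64 * (d + 1)).

(* The exponent of [2] is [n.+1] for the least natural number [n] exceeding
   [delta / 2], as required by [backward_euler_decay]. *)
Definition decay_const (R : realType) (delta c d : R) : R :=
  (2 ^+ (Num.truncn (delta / 2)).+2 / decay_rate c d) `^ (delta / 2).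

Section TraceDecay.
Variables (R : realType) (V : finType) (G : wgraph R V).
Variables (Gamma : set R[i]) (sigma : V -> V -> R[i]).
Local Notation normc := (@Normc.normc R).
Local Notation N := #|V|.

Hypothesis GammaP : Gamma = unit_circle R
  \/ (exists2 k : nat, (0 < k)%N & Gamma = cyclic_circle R k).
Hypothesis sig : signature G Gamma sigma.
Variables (delta c : R).
Hypotheses (hdelta : 1 < delta) (hc : 0 < c).
Hypothesis iso : isoperimetric_dim G Gamma sigma delta c.
Variables (D : 'I_N -> R) (phi : 'I_N -> {ffun V -> R[i]^o}).
Hypothesis phiE : forall j, magnetic_laplacian G sigma (phi j) = (D j)%:C *: phi j.
Hypothesis phi_ortho : forall i j, \sum_v phi i v * conjc (phi j v) = (i == j)%:R.
Hypothesis phi_complete : forall u v, \sum_j conjc (phi j u) * phi j v = (u == v)%:R.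

Local Notation K := (decay_const delta c (max_deg G)).
Local Notation A := (decay_rate c (max_deg G)).

Lemma decay_rate_gt0 : 0 < A.
Proof. by rewrite divr_gt0 ?exprn_gt0// mulr_gt0// ltr_wpDl// max_deg_ge0. Qed.

Lemma decay_const_gt0 : 0 < K.
Proof. by rewrite powR_gt0// divr_gt0 ?exprn_gt0// decay_rate_gt0. Qed.

Lemma iter_mass_ge0 s x k : 0 <= iter_mass D phi s x k.
Proof. by apply: sumr_ge0 => v _; exact: sqr_ge0. Qed.

(** With [M = sqrt (mu x)], the Nash inequality involves the mass only through its ratio to
    [2 mu x]. That ratio satisfies the hypothesis of [backward_euler_decay] with [q = delta / 2],
    and starts at [1 / (2 mu x)]. *)
Lemma iter_mass_decay s x k : 0 < s ->
  (2 * vmeas G x)^-1 <= K * s `^ (- (delta / 2)) ->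
  iter_mass D phi s x k <= 2 * vmeas G x * (K * (k.+1%:R * s) `^ (- (delta / 2))).
Proof.
move=> s0 hs; have mu0 := vmeas_gt0 G x.
have dd : 0 < delta by rewrite (lt_trans _ hdelta).
have q0 : 0 < delta / 2 by rewrite divr_gt0.
have m2 : 0 < 2 * vmeas G x by rewrite mulr_gt0.
rewrite -ler_pdivrMl// mulrC; move: k.
apply: (@backward_euler_decay R A (delta / 2) s (Num.truncn (delta / 2)).+1
  (fun k => iter_mass D phi s x k / (2 * vmeas G x))) => //.
- exact: decay_rate_gt0.
- by rewrite ltW// truncnS_gt.
- by move=> k; rewrite divr_ge0 ?iter_mass_ge0// ltW.
- move=> k; set g := rescaled G (resolvent_iter D phi s x k.+1).
  set a := iter_mass D phi s x k.+1.
  have aE : \sum_u vmeas G u * normc (g u) ^+ 2 = a.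
    by apply: eq_bigr => u _; exact: vmeas_normc_rescaled.
  have E0 := dirichlet_energy_ge0 G sigma g.
  have step := iter_mass_step GammaP sig phiE phi_ortho s0 x k.
  rewrite -/a -/g in step.
  have main : A * (a * (a / (2 * vmeas G x)) `^ (delta / 2)^-1) <=
      2 * dirichlet_energy G sigma g.
    have [a0|a0] := leP a 0.
      have -> : a = 0 by apply/eqP; rewrite eq_le a0 iter_mass_ge0.
      by rewrite mul0r mulr0 mulr_ge0.
    have M0 : 0 < Num.sqrt (vmeas G x) by exact: sqrt_vmeas_gt0.
    have := nash_inequality GammaP sig hdelta hc iso M0
      (iter_L1 GammaP sig phiE phi_ortho phi_complete s0 x k.+1).
    rewrite aE sqr_sqrtr ?(ltW mu0)// => /(_ a0).
    set y := 2 * vmeas G x / a.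
    have y0 : 0 < y by rewrite divr_gt0.
    have -> : a / (2 * vmeas G x) = y `^ (-1).
      by rewrite powR_inv1 ?ltW// /y invf_div.
    rewrite -powRrM exprMn -[(_ `^ _) ^+ 2]powR_mulrn ?powR_ge0// -powRrM.
    have -> : - delta^-1 * 2 = -1 * (delta / 2)^-1 by field; rewrite gt_eqF.
    set z := y `^ _ => h.
    have D0 : 0 < max_deg G + 1 by rewrite ltr_wpDl// max_deg_ge0.
    rewrite /decay_rate -ler_pdivlMl; last by rewrite divr_gt0 ?exprn_gt0// mulr_gt0.
    rewrite -(ler_pM2l (exprn_gt0 2 hc)) [c ^+ 2 * (_ * _)]mulrC.
    have -> : c ^+ 2 * ((c ^+ 2 / (64 * (max_deg G + 1)))^-1 * (2 * dirichlet_energy G sigma g))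
      = 128 * (max_deg G + 1) * dirichlet_energy G sigma g.
      by field; rewrite !gt_eqF.
    move: h; lra.
  rewrite -(ler_pM2r m2) mulrDl !divfK ?gt_eqF//.
  apply: le_trans step; rewrite lerD2l.
  have -> : A * s * (a / (2 * vmeas G x) * (a / (2 * vmeas G x)) `^ (delta / 2)^-1) *
     (2 * vmeas G x) = s * (A * (a * (a / (2 * vmeas G x)) `^ (delta / 2)^-1)).
    by field; rewrite gt_eqF.
  have -> : 2 * s * dirichlet_energy G sigma g = s * (2 * dirichlet_energy G sigma g).
    by ring.
  by rewrite ler_pM2l.
- by rewrite (iter_mass0 D phi_complete) div1r.
Qed.

Lemma heat_trace_le t : 0 < t ->
  \sum_j expR (- D j * t) <=
    2 * K * 2 `^ (delta / 2) * (vol G finset.setT / t `^ (delta / 2)).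
Proof.
move=> t0; have dd : 0 < delta by rewrite (lt_trans _ hdelta).
set q := delta / 2; have q0 : 0 < q by rewrite divr_gt0.
have K0 := decay_const_gt0.
(* A positive lower bound for the measure, defined also when [V] is empty. *)
pose m := (\sum_x (vmeas G x)^-1 + 1)^-1.
have S0 : 0 <= \sum_x (vmeas G x)^-1.
  by apply: sumr_ge0 => x _; rewrite invr_ge0 ltW// vmeas_gt0.
have m0 : 0 < m by rewrite invr_gt0 ltr_wpDl.
have mle x : m <= vmeas G x.
  rewrite /m -[leRHS]invrK lef_pV2 ?posrE ?invr_gt0 ?vmeas_gt0 ?ltr_wpDl//.
  rewrite (bigD1 x)//= -addrA lerDl addr_ge0//.
  by apply: sumr_ge0 => y _; rewrite invr_ge0 ltW// vmeas_gt0.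
(* Time steps below [e] make the initial value condition of [iter_mass_decay]
   true at every vertex. *)
pose e := (2 * m * K) `^ q^-1.
have e0 : 0 < e by rewrite powR_gt0// !mulr_gt0.
pose n := (Num.truncn (t / (2 * e))).+1.
have n0 : 0 < n%:R :> R by rewrite ltr0n.
pose s := t / (2 * n%:R).
have s0 : 0 < s by rewrite divr_gt0// mulr_gt0.
have se : s <= e.
  rewrite /s ler_pdivrMr ?mulr_gt0// mulrCA mulrA mulrC -ler_pdivrMr ?mulr_gt0//.
  by rewrite ltW// truncnS_gt.
have hs x : (2 * vmeas G x)^-1 <= K * s `^ (- q).
  have sq : s `^ q <= 2 * vmeas G x * K.
    apply: (@le_trans _ _ (e `^ q)).
      by apply: ge0_ler_powR; rewrite ?nnegrE//; exact: ltW.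
    rewrite /e -powRrM mulVf ?gt_eqF// powRr1; last by rewrite ltW// !mulr_gt0.
    by rewrite ler_pM2r// ler_pM2l.
  rewrite powRN ler_pdivlMr ?powR_gt0// ler_pdivrMl ?mulr_gt0 ?vmeas_gt0//.
have ns : n%:R * s = t / 2 by rewrite /s; field; rewrite gt_eqF.
have D0 := eigenvalue_ge0 GammaP sig phiE phi_ortho.
apply: (@le_trans _ _ (\sum_x iter_mass D phi s x n)).
  rewrite (sum_iter_mass D phi_ortho); apply: ler_sum => j _.
  have ->: - D j * t = - (s * D j * (n * 2)%:R).
    rewrite natrM mulrA [s * D j * _]mulrAC [s * n%:R]mulrC ns; by field.
  rewrite expRN expRM_natr /resolvent_coef exprVn -exprM.
  have sD : 0 <= s * D j by rewrite mulr_ge0// ltW.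
  rewrite lef_pV2 ?posrE ?exprn_gt0 ?expR_gt0 ?ltr_pwDl//.
  by rewrite lerXn2r ?nnegrE ?expR_ge0 ?addr_ge0// expR_ge1Dx.
have -> : 2 * K * 2 `^ q * (vol G finset.setT / t `^ q) =
    \sum_x 2 * vmeas G x * (K * (t / 2) `^ (- q)).
  rewrite -mulr_suml -mulr_sumr /vol (eq_bigl xpredT); last by move=> x; rewrite inE.
  have -> : t `^ q = (t / 2) `^ q * 2 `^ q.
    by rewrite -powRM ?divr_ge0// ?(ltW t0)// divfK// pnatr_eq0.
  by rewrite powRN; field; rewrite !gt_eqF ?powR_gt0 ?divr_gt0.
apply: ler_sum => x _; apply: le_trans (iter_mass_decay _ s0 (hs x)) _.
have t2 : 0 < t / 2 by rewrite divr_gt0.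
(* The decay bound after [n] steps is stated at time [(n + 1) s], which is at least
   [n s = t / 2]. *)
have tn : t / 2 <= n.+1%:R * s by rewrite -ns ler_pM2r// ler_nat.
have n1 : 0 < n.+1%:R * s by exact: lt_le_trans tn.
rewrite ler_pM2l ?mulr_gt0 ?vmeas_gt0// ler_pM2l// !powRN lef_pV2 ?posrE ?powR_gt0//.
by apply: ge0_ler_powR; rewrite ?nnegrE//; exact: ltW.
Qed.

End TraceDecay.

Local Close Scope complex_scope.

Theorem theorem5p6 (R : realType) (delta c d : R)
    (hdelta : 2 < delta) (hc : 0 < c) :
  exists C : R,
    forall (V : finType) (G : wgraph R V)
           (Gamma : set R[i]) (sigma : V -> V -> R[i]) (lam : #|V|.-tuple R),
      Gamma = unit_circle R
        \/ (exists2 k : nat, (0 < k)%N & Gamma = cyclic_circle R k) ->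
      signature G Gamma sigma ->
      isoperimetric_dim G Gamma sigma delta c ->
      max_deg G = d ->
      is_spectrum G sigma lam ->
      forall t : R, 0 < t ->
        \sum_(j < #|V|) expR (- tnth lam j * t)
          <= C * (vol G [set: V] / t `^ (delta / 2)).
Proof.
exists (2 * decay_const delta c d * 2 `^ (delta / 2)).
move=> V G Gamma sigma lam GammaP sig iso <- spec t t0.
have hdelta1 : 1 < delta by rewrite (lt_trans _ hdelta)// ltr1n.
have [D [phi [phiE ortho complete]]] := orthonormal_eigenbasis GammaP sig.
have Dlam := spectrum_perm phiE ortho spec.
rewrite -(big_tuple _ _ lam xpredT (fun x => expR (- x * t))).
rewrite -(perm_big _ Dlam) big_map big_enum/=.
exact: (heat_trace_le GammaP sig hdelta1 hc iso phiE ortho complete).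
Qed.
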